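(* Assume that $\mathcal{X}$ is nonempty and define $\gamma_N=\frac1N+\left(1-\frac1N\right)\gamma\le1$. Let $\{x^k\}_{k\ge0}$ be generated by algorithm SPA with stepsizes $0<\alpha_k<\frac{2}{\gamma_N}$. Then $$\mathbf{E}\left[\|x^{k+1}-x^*\|^2\,|\,x^k\right]\le\|x^k-x^*\|^2-2(2\alpha_k-\alpha_k^2\gamma_N)F(x^k)$$ for all $k\ge0$ and all $x^*\in\mathcal{X}$. Moreover, the fastest decrease (i.e. the largest value of $2\alpha_k-\alpha_k^2\gamma_N$) is given by the constant stepsize $\alpha_k=1/\gamma_N$. If, additionally, exactness holds, i.e. $\mathcal{X}=\{x\in\mathbb{R}^n:\mathbf{P}(x\in\mathcal{X}_S)=1\}$, and the stepsizes satisfy $\delta\le\alpha_k\le\frac{2}{\gamma_N}-\delta$ for all $k$, for some $0<\delta\le\frac{1}{\gamma_N}$, then the sequence $x^k$ converges almost surely to a random point in the set $\mathcal{X}$ and $\lim_{k\to\infty}F(x^k)=0$ almost surely.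
   Context: $\mathcal{X}\subseteq\mathbb{R}^n$ is a closed convex set and $(\Omega,\mathbf{P})$ is a probability space with random variable $S\sim\mathbf{P}$. For every $S\in\Omega$, $\mathcal{X}_S$ is a random closed convex subset of $\mathbb{R}^n$ with $\mathcal{X}\subseteq\mathcal{X}_S$; as part of ''random set'', the maps $(S,x)\mapsto\Pi_{\mathcal{X}_S}(x)$ are measurable. $\Pi_C$ is the Euclidean projection onto $C$. $F(x)=\frac12\mathbf{E}[\|x-\Pi_{\mathcal{X}_S}(x)\|^2]$, expectation over $S\sim\mathbf{P}$. $\gamma\ge0$ is the smallest constant such that $\|\mathbf{E}[x-\Pi_{\mathcal{X}_S}(x)]\|^2\le\gamma\,\mathbf{E}[\|x-\Pi_{\mathcal{X}_S}(x)\|^2]$ for all $x\in\mathbb{R}^n$ (by Jensen, $\gamma\le1$). Algorithm SPA: choose (deterministic) $x^0\in\mathbb{R}^n$, minibatch size $N\ge1$ and positive stepsizes $\{\alpha_k\}_{k\ge0}$; for $k\ge0$, draw $N$ independent samples $S_1^k,\dots,S_N^k\sim\mathbf{P}$ (independent of the past) and set $x^{k+1}=x^k-\alpha_k\left(x^k-\frac1N\sum_{i=1}^N\Pi_{\mathcal{X}_{S_i^k}}(x^k)\right)$. *)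

(* Defs.v *)
From HB Require Import structures.
From mathcomp Require Export all_boot all_order all_algebra.
From mathcomp Require Export all_classical all_reals all_analysis.
Export Order.TTheory GRing.Theory Num.Theory.
Export numFieldNormedType.Exports.

Set Implicit Arguments.
Unset Strict Implicit.
Unset Printing Implicit Defensive.

Local Open Scope classical_set_scope.
Local Open Scope ring_scope.

(* The library norm on 'rV[R]_n is the sup norm, hence a separate Euclidean
   norm.  Both induce the same topology, so the library's [closed], [open] and
   convergence on 'rV[R]_n are the usual ones of R^n. *)
Definition enorm (R : realType) (n : nat) (x : 'rV[R]_n) : R :=
  Num.sqrt (\sum_(i < n) x 0 i ^+ 2).

(* R^n with its Borel sigma-algebra; convertible to 'rV[R]_n. *)
Notation borel_rV R n := (g_sigma_algebraType (@open 'rV[R]_n)).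

(* A point of C nearest to x; it exists and is unique when C is nonempty,
   closed and convex.  The default value 0 is used only if there is none. *)
Definition proj (R : realType) (n : nat) (C : set 'rV[R]_n) (x : 'rV[R]_n) :
    'rV[R]_n :=
  xget 0 [set p | C p /\ forall q, C q -> enorm (x - p) <= enorm (x - q)].

Section expectations.
Context (R : realType) (d : measure_display) (Omega : measurableType d).
Variable P : probability Omega R.

Definition expect_rV (n : nat) (Y : Omega -> 'rV[R]_n) : 'rV[R]_n :=
  \row_(i < n) fine 'E_P[fun s => (Y s 0 i)%R]%E.

(* Z is a version of the conditional expectation of Y given the
   sigma-algebra G. *)
Definition is_cond_expectation (G : set (set Omega)) (Y Z : Omega -> R) : Prop :=
  [/\ G `<=` measurable,
      P.-integrable setT (EFin \o Y),
      P.-integrable setT (EFin \o Z),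
      (forall B, measurable B -> G (Z @^-1` B)) &
      (forall A, G A ->
        (\int[P]_(w in A) (Z w)%:E = \int[P]_(w in A) (Y w)%:E)%E)].

Definition sigma_generated (d' : measure_display) (U : measurableType d')
    (X : Omega -> U) : set (set Omega) :=
  preimage_set_system setT X measurable.

Definition mutually_independent (d' : measure_display) (U : measurableType d')
    (I : eqType) (X : I -> Omega -> U) : Prop :=
  forall (J : seq I) (A : I -> set U), uniq J ->
    (forall j, measurable (A j)) ->
    P (\bigcap_(j in [set` J]) (X j @^-1` A j)) =
    (\prod_(j <- J) P (X j @^-1` A j))%E.

Definition iid_samples (d' : measure_display) (U : measurableType d')
    (Q : probability U R) (I : eqType) (X : I -> Omega -> U) : Prop :=
  [/\ (forall j, measurable_fun setT (X j)),
      (forall j A, measurable A -> P (X j @^-1` A) = Q A) &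
      mutually_independent X].

End expectations.

Section feasibility.
Context (R : realType) (n : nat).
Context (d : measure_display) (Omega : measurableType d).
Variables (P : probability Omega R) (XS : Omega -> set 'rV[R]_n).

Definition mean_sqdist (x : 'rV[R]_n) : R :=
  fine 'E_P[fun s => (enorm (x - proj (XS s) x) ^+ 2)%R]%E.

Definition F (x : 'rV[R]_n) : R := 2^-1 * mean_sqdist x.

Definition gamma_constants : set R :=
  [set g | 0 <= g /\ forall x : 'rV[R]_n,
    enorm (expect_rV P (fun s => x - proj (XS s) x)) ^+ 2
      <= g * mean_sqdist x].

(* [S (k, i)] is the i-th sample drawn at iteration k. *)
Fixpoint spa (T : Type) (N : nat) (x0 : 'rV[R]_n) (alpha : nat -> R)
    (S : nat * 'I_N -> T -> Omega) (k : nat) (w : T) : 'rV[R]_n :=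
  if k is j.+1 then
    let x := spa x0 alpha S j w in
    x - alpha j *: (x - N%:R^-1 *: \sum_(i < N) proj (XS (S (j, i) w)) x)
  else x0.

End feasibility.

Definition gamma_minibatch (R : realType) (N : nat) (gamma : R) : R :=
  N%:R^-1 + (1 - N%:R^-1) * gamma.

(* Main.v *)
(* Write r_s(x) = x - proj X_s x and M(x) = E|r_s(x)|^2 = 2 F(x).  The obtuse
   angle property of projections gives <r_s(x), x - z> >= |r_s(x)|^2 for z in X.
   Expanding |x^{k+1} - z|^2 and integrating out the fresh samples, which are
   independent of x^k, yields an explicit polynomial expression in x^k - z,
   E r_s(x^k) and M(x^k); it is a version of the conditional expectation, and
   the bound follows from |E r_s|^2 <= gamma M.

   For the convergence no supermartingale theorem is needed.  Taking expectations
   in the descent inequality bounds the sum of the E M(x^k), so both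
   sum_k M(x^k) and sum_k |r_{S^k}(x^k)|^2 are finite almost surely.  Pathwise,
   |x^{k+1} - z|^2 <= |x^k - z|^2 + alpha_k^2 (1/N) sum_i |r_{S_i^k}(x^k)|^2, so
   almost every path is quasi-Fejer monotone with respect to X; its cluster
   points y satisfy M(y) = 0, hence lie in X by exactness, hence the path
   converges. *)
From HB Require Import structures.
From mathcomp Require Import ring lra measurable_realfun.
Require Import Defs.

Set Implicit Arguments.
Unset Strict Implicit.
Unset Printing Implicit Defensive.

Local Open Scope classical_set_scope.
Local Open Scope ring_scope.

(** * Euclidean projection *)

Section euclidean.
Context (R : realType) (n : nat).
Implicit Types (x y z : 'rV[R]_n) (C : set 'rV[R]_n).

Definition dotv x y : R := \sum_(i < n) x 0 i * y 0 i.
(** The squared Euclidean norm, kept free of square roots so that norm identities are polynomial and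
    open to [ring] and [lra]. *)
Definition sqn x : R := dotv x x.

Lemma dotvC x y : dotv x y = dotv y x.
Proof. by apply: eq_bigr => i _; rewrite mulrC. Qed.

Lemma dotvDl x y z : dotv (x + y) z = dotv x z + dotv y z.
Proof. by rewrite -big_split; apply: eq_bigr => i _; rewrite mxE mulrDl. Qed.

Lemma dotvZl a x y : dotv (a *: x) y = a * dotv x y.
Proof. by rewrite mulr_sumr; apply: eq_bigr => i _; rewrite mxE mulrA. Qed.

Lemma dotvDr x y z : dotv x (y + z) = dotv x y + dotv x z.
Proof. by rewrite dotvC dotvDl !(dotvC x). Qed.

Lemma dotvZr a x y : dotv x (a *: y) = a * dotv x y.
Proof. by rewrite dotvC dotvZl dotvC. Qed.

Lemma dotvNl x y : dotv (- x) y = - dotv x y.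
Proof. by rewrite -scaleN1r dotvZl mulN1r. Qed.

Lemma dotvNr x y : dotv x (- y) = - dotv x y.
Proof. by rewrite dotvC dotvNl dotvC. Qed.

Lemma dotv_suml (I : finType) (f : I -> 'rV[R]_n) y :
  dotv (\sum_i f i) y = \sum_i dotv (f i) y.
Proof.
rewrite exchange_big; apply: eq_bigr => l _ /=.
by rewrite summxE mulr_suml.
Qed.

Lemma dotv_sumr (I : finType) (f : I -> 'rV[R]_n) y :
  dotv y (\sum_i f i) = \sum_i dotv y (f i).
Proof. by rewrite dotvC dotv_suml; apply: eq_bigr => i _; rewrite dotvC. Qed.

Definition dotvE := (dotvDl, dotvDr, dotvNl, dotvNr, dotvZl, dotvZr).

Lemma sqn_ge0 x : 0 <= sqn x.
Proof. by apply: sumr_ge0 => i _; rewrite -expr2 sqr_ge0. Qed.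

Lemma enorm_sqr x : enorm x ^+ 2 = sqn x.
Proof.
rewrite sqr_sqrtr; first by apply: eq_bigr => i _; rewrite expr2.
by apply: sumr_ge0 => i _; exact: sqr_ge0.
Qed.

Lemma enorm_ge0 x : 0 <= enorm x.
Proof. exact: sqrtr_ge0. Qed.

Lemma ler_enorm x y : (enorm x <= enorm y) = (sqn x <= sqn y).
Proof. by rewrite -!enorm_sqr ler_sqr// nnegrE enorm_ge0. Qed.

Lemma coord_sqr_le x i : x 0 i ^+ 2 <= sqn x.
Proof.
rewrite /sqn /dotv (bigD1 i)//= -expr2 lerDl.
by apply: sumr_ge0 => j _; rewrite -expr2 sqr_ge0.
Qed.

Lemma sqn_eq0 x : sqn x = 0 -> x = 0.
Proof.
move=> x0; apply/rowP => i; rewrite mxE; apply/eqP.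
by rewrite -sqrf_eq0 eq_le sqr_ge0 andbT -x0 coord_sqr_le.
Qed.

Lemma sqnD_le x y : sqn (x + y) <= 2 * sqn x + 2 * sqn y.
Proof.
have := sqn_ge0 (x - y); rewrite /sqn !dotvE (dotvC y x) => ?; lra.
Qed.

Lemma sqnBC x y : sqn (x - y) = sqn (y - x).
Proof. by rewrite /sqn -opprB dotvNl dotvNr opprK. Qed.

(** The library norm is the sup norm; this comparison carries Euclidean smallness and boundedness
    over to the library topology. *)
Lemma normr_le_enorm x : `|x| <= enorm x.
Proof.
rewrite [leLHS]/Num.norm/= mx_normrE; apply/bigmax_leP; split=> [|[i j] _ /=].
  exact: enorm_ge0.
rewrite ord1 -(@ler_pXn2r _ 2)// ?nnegrE ?enorm_ge0// enorm_sqr.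
by rewrite real_normK ?num_real// coord_sqr_le.
Qed.

Lemma sqn_continuous x : continuous (fun y => sqn (x - y)).
Proof.
apply: continuous_big => [|i _]; first exact: add_continuous.
have h : continuous (fun y : 'rV[R]_n => (x - y) 0 i).
  rewrite (_ : (fun _ => _) = (fun y => x 0 i - y 0 i)).
    move=> y.
    apply: (@continuousB _ _ _ (cst (x 0 i)) (fun y : 'rV[R]_n => y 0 i)).
      exact: cst_continuous.
    exact: (@coord_continuous R 1 n 0 i y).
  by apply/funext => y; rewrite !mxE.
by move=> y; apply: continuousM; exact: h.
Qed.

Lemma sqn_cvg (u : nat -> 'rV[R]_n) y :
  (forall e, 0 < e -> \forall k \near \oo, sqn (u k - y) < e) ->
  u k @[k --> \oo] --> y.
Proof.
move=> h; apply/cvgrPdistC_lt => e e0.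
have := h (e ^+ 2) (exprn_gt0 _ e0); apply: filterS => k.
rewrite -enorm_sqr ltr_sqr ?nnegrE ?enorm_ge0 ?ltW//.
exact: le_lt_trans (normr_le_enorm _).
Qed.

Lemma sqn_bounded_compact C x r : closed C ->
  compact (C `&` [set y | sqn (x - y) <= r]).
Proof.
move=> cC; apply: bounded_closed_compact; last first.
  apply: closedI => //.
  have /continuous_closedP/(_ [set t : R | t <= r]) := @sqn_continuous x.
  by apply; exact: closed_le.
exists (`|x| + (1 + r)); split; first exact: num_real.
move=> M rM y [_ /= yr]; apply: (le_trans _ (ltW rM)).
have -> : y = x - (x - y) by rewrite subKr.
apply: (le_trans (ler_normB _ _)); rewrite lerD2l.
apply: (le_trans (normr_le_enorm _)).
(* [t <= 1 + t ^+ 2] turns the bound on the square into one on the norm, which explains the radius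
   [1 + r]. *)
move: yr; rewrite -enorm_sqr; move: (enorm _) => t tr.
have := sqr_ge0 (t - 1); have := sqr_ge0 t; rewrite sqrrB expr1n mulr1 => ? ?.
lra.
Qed.

Section projection.
Variable C : set 'rV[R]_n.
Hypotheses (C_closed : closed C) (C0 : C !=set0).

(** [C] may be unbounded, so the distance is minimised over the compact part of [C] no farther from
    [x] than some [q0] in [C]; the other points of [C] cannot beat [q0]. A minimiser thus exists,
    and [xget] returns one rather than its default. *)
Lemma proj_nearest x :
  C (proj C x) /\ forall q, C q -> sqn (x - proj C x) <= sqn (x - q).
Proof.
have [q0 Cq0] := C0.
have [] := @EVT_min_rV R n (fun y => sqn (x - y))
  (C `&` [set y | sqn (x - y) <= sqn (x - q0)]).
- by exists q0; split=> //=.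
- exact: sqn_bounded_compact.
- by apply: continuous_subspaceT; exact: sqn_continuous.
move=> p; rewrite inE => -[Cp /= pq0] pmin.
have : [set p | C p /\ forall q, C q -> enorm (x - p) <= enorm (x - q)] p.
  split=> // q Cq; rewrite ler_enorm.
  have [qq0|/ltW] := leP (sqn (x - q)) (sqn (x - q0)).
    by apply: pmin; rewrite inE.
  exact: le_trans.
by move=> /(xgetI 0)[Cx h]; split=> // q /h; rewrite ler_enorm.
Qed.

Lemma proj_in x : C (proj C x).
Proof. by have [] := proj_nearest x. Qed.

Lemma proj_min x q : C q -> sqn (x - proj C x) <= sqn (x - q).
Proof. by have [_] := proj_nearest x; exact. Qed.

(** [proj C x] competes with [proj C y], at distance [(x - proj C x) + (y - x)] from [y]. This
    estimate does the work of continuity of the squared distance. *)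
Lemma sqdist_le x y :
  sqn (y - proj C y) <= 2 * sqn (x - proj C x) + 2 * sqn (y - x).
Proof.
apply: le_trans (proj_min _ (proj_in x)) _.
by rewrite -(subrKA x y) addrC sqnD_le.
Qed.

Lemma sqdist_eq0 x : (sqn (x - proj C x) = 0) <-> C x.
Proof.
split=> [/sqn_eq0/eqP|Cx].
  by rewrite subr_eq0 => /eqP ->; exact: proj_in.
apply/eqP; rewrite eq_le sqn_ge0 andbT (le_trans (proj_min _ Cx))// subrr.
by rewrite /sqn -[X in dotv X _](scale0r 0) dotvZl mul0r.
Qed.

Hypothesis C_convex : convex_set C.

(** First-order optimality: by convexity the segment from [p] to [q] lies in [C], and comparing [p]
    with [p + t *: (q - p)] gives [2 * t * a <= t ^+ 2 * b] for [t] in [0, 1]. *)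
Lemma proj_obtuse x q : C q -> dotv (x - proj C x) (q - proj C x) <= 0.
Proof.
move=> Cq; set p := proj C x; set a := dotv _ _; set b := sqn (q - p).
have h t : 0 <= t <= 1 -> 2 * t * a <= t ^+ 2 * b.
  move=> t01.
  have : C (p + t *: (q - p)).
    have pt : 0 <= t <= 1 := t01.
    pose T := Itv01 (andP pt).1 (andP pt).2.
    have := C_convex T (mem_set Cq) (mem_set (proj_in x)).
    rewrite inE; congr C; rewrite /conv/= -/p.
    by rewrite scalerBr scalerBl scale1r addrCA addrA.
  move=> /(proj_min x); rewrite -/p opprD addrA.
  rewrite /b /a; move: (x - p) (q - p) => u v.
  rewrite /sqn !dotvE (dotvC v u) => ?; lra.
(* For [a > 0] the step [t = a / (a + b)] contradicts [h]. *)
have [//|a0] := leP a 0.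
have b0 : 0 <= b := sqn_ge0 _.
have ab0 : 0 < a + b by rewrite ltr_wpDr.
have t0 : 0 < a / (a + b) by rewrite divr_gt0.
have := h (a / (a + b)).
rewrite ltW//= ler_pdivrMr// mul1r lerDl b0 => /(_ isT).
rewrite mulrAC expr2 -[leRHS]mulrA [leRHS]mulrC ler_pM2r//.
rewrite mulrAC ler_pdivlMr//; nra.
Qed.

Lemma proj_dot x q : C q -> sqn (x - proj C x) <= dotv (x - proj C x) (x - q).
Proof.
move=> /(proj_obtuse x); set p := proj C x => le0.
have -> : x - q = (x - p) - (q - p) by rewrite opprB subrKA.
by rewrite dotvDr dotvNr lerDl oppr_ge0.
Qed.

End projection.
End euclidean.

(** * The deterministic step and quasi-Fejer sequences *)

Section minibatch_step.
Context (R : realType) (n N : nat).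
Implicit Types (x z : 'rV[R]_n) (r : 'I_N -> 'rV[R]_n).

(** The quadratic term stays a double sum because, once averaged, its diagonal and off-diagonal
    terms behave differently. *)
Lemma sqn_step x z (a : R) r :
  sqn (x - a *: (N%:R^-1 *: \sum_i r i) - z) =
  sqn (x - z) - 2 * a * (N%:R^-1 * \sum_i dotv (r i) (x - z)) +
  a ^+ 2 * (N%:R^-1 ^+ 2 * \sum_i \sum_j dotv (r i) (r j)).
Proof.
rewrite addrAC; move: (x - z) => v.
rewrite -dotv_suml.
have -> : \sum_i \sum_j dotv (r i) (r j) = sqn (\sum_i r i).
  by rewrite /sqn dotv_suml; apply: eq_bigr => i _; rewrite dotv_sumr.
by move: (\sum_i r i) => s; rewrite /sqn !dotvE (dotvC v s); ring.
Qed.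

(** Sum [2 <u, v> <= |u|^2 + |v|^2] over all pairs: this is convexity of the squared norm. *)
Lemma sum_dotv_le r :
  \sum_i \sum_j dotv (r i) (r j) <= N%:R * \sum_i sqn (r i).
Proof.
have le2 i j : dotv (r i) (r j) <= 2^-1 * sqn (r i) + 2^-1 * sqn (r j).
  have := sqn_ge0 (r i - r j); rewrite /sqn !dotvE (dotvC (r j)) => ?; lra.
apply: (@le_trans _ _ (\sum_i \sum_j (2^-1 * sqn (r i) + 2^-1 * sqn (r j)))).
  by apply: ler_sum => i _; apply: ler_sum => j _; exact: le2.
under eq_bigr do rewrite big_split /= sumr_const card_ord -mulr_sumr.
rewrite big_split /= sumr_const card_ord sumrMnl.
rewrite -mulr_sumr -mulrnDl mulr_natl.
by rewrite [2^-1 * _]mulrC -splitr.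
Qed.

(** Pathwise form of the step: the inner products have a favourable sign and are dropped, and
    [sum_dotv_le] bounds the square of the average by the average of the squares. *)
Lemma sqn_step_le x z (a : R) r : (0 < N)%N -> 0 <= a ->
  (forall i, 0 <= dotv (r i) (x - z)) ->
  sqn (x - a *: (N%:R^-1 *: \sum_i r i) - z) <=
  sqn (x - z) + a ^+ 2 * (N%:R^-1 * \sum_i sqn (r i)).
Proof.
move=> N0 a0 r0; rewrite sqn_step.
have NR : 0 < N%:R :> R by rewrite ltr0n.
apply: lerD.
  rewrite gerDl oppr_le0; apply: mulr_ge0; first exact: mulr_ge0.
  by apply: mulr_ge0; [rewrite invr_ge0 ltW|exact: sumr_ge0].
apply: ler_wpM2l; first exact: sqr_ge0.
rewrite expr2 -mulrA ler_pM2l ?invr_gt0// mulrC ler_pdivrMr// mulrC.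
exact: sum_dotv_le.
Qed.

End minibatch_step.

Section fejer.
Context (R : realType) (n : nat).

Lemma cluster_sqn (u : nat -> 'rV[R]_n) y : cluster (u @ \oo) y ->
  forall e K, 0 < e -> exists2 k, (K <= k)%N & sqn (u k - y) < e.
Proof.
move=> uy e K e0.
have := uy [set u k | k in [set k | (K <= k)%N]] [set z | sqn (y - z) < e].
case.
- by exists K => // k Kk; exists k.
- have /continuousP/(_ [set t : R | t < e]) := @sqn_continuous R n y.
  move=> /(_ (@open_lt _ e)) op.
  apply: open_nbhs_nbhs; split=> //=.
  by rewrite subrr /sqn /dotv big1// => i _; rewrite mxE mul0r.
by move=> _ [[k Kk <-] /= h]; exists k => //; rewrite sqnBC.
Qed.

(** The sequence is bounded, hence has a cluster point [y], which lies in [X]. Once some [u k0] is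
    close to [y] and the tail of the series is small, the inequality at [y] itself keeps all later
    terms close. *)
Lemma quasi_fejer_cvg (X : set 'rV[R]_n) (u : nat -> 'rV[R]_n) (b : nat -> R) :
  X !=set0 -> (forall k, 0 <= b k) -> cvgn (series b) ->
  (forall z k, X z -> sqn (u k.+1 - z) <= sqn (u k - z) + b k) ->
  cluster (u @ \oo) `<=` X ->
  exists2 y, X y & u k @[k --> \oo] --> y.
Proof.
move=> [z Xz] b0 cb ub uX; pose L := limn (series b).
have ndb : nondecreasing_seq (series b).
  by move=> i j; apply: nondecreasing_series.
have bL k : series b k <= L by exact: nondecreasing_cvgn_le.
(* The one-step inequality telescoped from [k0] to [k]; the error is a difference of partial
   sums. *)
have step w k0 k : X w -> (k0 <= k)%N ->
    sqn (u k - w) <= sqn (u k0 - w) + (series b k - series b k0).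
  move=> Xw; elim: k => [|k IH].
    by rewrite leqn0 => /eqP ->; rewrite subrr addr0.
  rewrite leq_eqVlt ltnS => /predU1P[->|/IH h]; first by rewrite subrr addr0.
  have := ub w k Xw; rewrite seriesSr; lra.
(* The whole sequence stays in the ball around [z] of squared radius [sqn (u 0 - z) + L], which is
   compact. *)
have [|y [_ cy]] := @sqn_bounded_compact R n setT z (sqn (u 0%N - z) + L)
  closedT (u @ \oo) _.
  exists 0%N => // k _ /=; split=> //; rewrite sqnBC.
  apply: (le_trans (step z 0%N k Xz _)) => //.
  have -> : series b 0%N = 0 by rewrite /series/= big_geq.
  by rewrite lerD2l subr0; exact: bL.
have Xy := uX _ cy; exists y => //; apply: sqn_cvg => e e0.
have e20 : 0 < e / 2 by rewrite divr_gt0.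
have [K _ bK] : \forall k \near \oo, L - series b k < e / 2.
  have /cvgrPdist_lt/(_ _ e20) := cb.
  by apply: filterS => k; exact: le_lt_trans (ler_norm _).
have [k0 Kk0 uk0] := cluster_sqn cy K e20.
exists k0 => // k /= k0k; apply: le_lt_trans (step y k0 k Xy k0k) _.
rewrite [ltRHS]splitr ltrD//; apply: le_lt_trans (bK k0 Kk0).
by rewrite lerD2r.
Qed.

End fejer.

(** * Measurability and means *)

Section borel_row_vectors.
Context (R : realType) (n : nat).

Lemma measurable_coord (i : 'I_n) :
  measurable_fun setT (fun x : borel_rV R n => (x : 'rV[R]_n) 0 i).
Proof.
apply: (measurability _ (RGenOpens.measurableE R)).
move=> _ [_ [a [b ->] <-]]; rewrite setTI; apply: sub_sigma_algebra.
have /continuousP := @coord_continuous R 1 n 0 i.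
by apply; exact: interval_open.
Qed.

(** Every open set is a countable union of rational boxes, and the preimage of a box is a finite
    intersection of coordinate conditions. *)
Lemma measurable_rV d (T : measurableType d) (f : T -> 'rV[R]_n) :
  (forall i, measurable_fun setT (fun w => f w 0 i)) ->
  measurable_fun setT (f : T -> borel_rV R n).
Proof.
move=> mf.
apply: (@measurability _ _ T (borel_rV R n) setT f (@open 'rV[R]_n)) => //.
move=> _ [U oU <-]; rewrite setTI.
(* Boxes with a rational centre [p.1] and half-width [1 / (p.2 + 1)]; the index type is
   countable. *)
pose box (p : 'rV[rat]_n * nat) : set 'rV[R]_n :=
  [set y | forall i, `|y 0 i - ratr (p.1 0 i)| < p.2.+1%:R^-1].
have -> : f @^-1` U =
    \bigcup_p (if `[< box p `<=` U >] then f @^-1` box p else set0).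
  apply/seteqP; split=> [w /= Uw|w [p _]]; last first.
    by case: asboolP => // pU wp; exact: pU.
  have /nbhs_ballP[e /= e0 eU] : nbhs (f w) U by exact: open_nbhs_nbhs.
  (* Two points of one box differ by less than [2 / (m + 1)] in each coordinate, so a box containing
     [f w] stays in the [e]-ball around it. *)
  have [m me] : exists m, 2 * m.+1%:R^-1 < e.
    have [m _ /(_ m (leqnn _)) /= h] :=
      near_infty_natSinv_lt (PosNum (divr_gt0 e0 (ltr0n R 2))).
    by exists m; rewrite mulrC -ltr_pdivlMr.
  have m0 : 0 < m.+1%:R^-1 :> R by rewrite invr_gt0.
  have /choice[q qw] (i : 'I_n) :
      exists r : rat, `|f w 0 i - ratr r| < m.+1%:R^-1.
    have : f w 0 i - m.+1%:R^-1 < f w 0 i + m.+1%:R^-1.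
      by rewrite ltrD2l (lt_trans _ m0)// oppr_lt0.
    move=> /rat_in_itvoo[r]; rewrite in_itv/= => /andP[h1 h2].
    by exists r; rewrite distrC ltr_distl h1.
  exists (\row_i q i, m) => //.
  have wbox : box (\row_i q i, m) (f w) by move=> i /=; rewrite mxE.
  rewrite asboolT// => y ybox; apply: eU.
  split=> // i j; rewrite ord1 /ball/=.
  have := ybox j; have := wbox j; rewrite /= mxE => h1 h2.
  rewrite -(subrKA (ratr (q j))) (le_lt_trans (ler_normD _ _))//.
  apply: lt_trans me; rewrite mulr_natl mulr2n ltrD//.
  by rewrite distrC.
apply: countable_bigcupT_measurable; first exact: countableP.
move=> p; case: asboolP => // _.
rewrite (_ : _ @^-1` _ = \bigcap_(i in [set: 'I_n])
    [set w | `|f w 0 i - ratr (p.1 0 i)| < p.2.+1%:R^-1]); last first.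
  by apply/seteqP; split=> w h i /=; [move=> _; exact: h|exact: h].
apply: fin_bigcap_measurable => // i _.
rewrite -[X in measurable X]setTI.
apply: (measurable_fun_ltr (f := fun w => `|f w 0 i - ratr (p.1 0 i)|)
  (g := cst p.2.+1%:R^-1)) => //.
apply: measurableT_comp => //; exact: measurable_funB.
Qed.

Lemma measurable_dotv d (T : measurableType d) (f g : T -> 'rV[R]_n) :
  measurable_fun setT (f : T -> borel_rV R n) ->
  measurable_fun setT (g : T -> borel_rV R n) ->
  measurable_fun setT (fun w => dotv (f w) (g w)).
Proof.
move=> mf mg; apply: measurable_sum => i; apply: measurable_funM.
  exact: (measurableT_comp (measurable_coord i) mf).
exact: (measurableT_comp (measurable_coord i) mg).
Qed.

Lemma measurable_addv d (T : measurableType d) (f g : T -> 'rV[R]_n) :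
  measurable_fun setT (f : T -> borel_rV R n) ->
  measurable_fun setT (g : T -> borel_rV R n) ->
  measurable_fun setT ((fun w => f w + g w) : T -> borel_rV R n).
Proof.
move=> mf mg; apply: measurable_rV => i.
under eq_fun do rewrite mxE.
apply: measurable_funD.
  exact: (measurableT_comp (measurable_coord i) mf).
exact: (measurableT_comp (measurable_coord i) mg).
Qed.

Lemma measurable_scalev d (T : measurableType d) (a : R) (f : T -> 'rV[R]_n) :
  measurable_fun setT (f : T -> borel_rV R n) ->
  measurable_fun setT ((fun w => a *: f w) : T -> borel_rV R n).
Proof.
move=> mf; apply: measurable_rV => i.
under eq_fun do rewrite mxE.
apply: measurable_funM => //.
exact: (measurableT_comp (measurable_coord i) mf).
Qed.

Lemma measurable_subv d (T : measurableType d) (f g : T -> 'rV[R]_n) :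
  measurable_fun setT (f : T -> borel_rV R n) ->
  measurable_fun setT (g : T -> borel_rV R n) ->
  measurable_fun setT ((fun w => f w - g w) : T -> borel_rV R n).
Proof.
move=> mf mg; apply: measurable_addv => //.
under eq_fun do rewrite -scaleN1r.
exact: measurable_scalev.
Qed.

Lemma measurable_sumv d (T : measurableType d) (I : finType)
    (f : I -> T -> 'rV[R]_n) :
  (forall i, measurable_fun setT (f i : T -> borel_rV R n)) ->
  measurable_fun setT ((fun w => \sum_i f i w) : T -> borel_rV R n).
Proof.
move=> mf; apply: measurable_rV => l.
under eq_fun do rewrite summxE.
apply: measurable_sum => i.
exact: (measurableT_comp (measurable_coord l) (mf i)).
Qed.

End borel_row_vectors.

Section bounded_measurable.
Context (R : realType) d (T : measurableType d) (P : probability T R).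
Implicit Types f g : T -> R.

(** At each fixed iteration every random quantity involved is bounded. This class is closed under
    sums and products, and its members are integrable for a probability. *)
Definition bounded_measurable f :=
  measurable_fun setT f /\ exists C, forall w, `|f w| <= C.

Lemma bounded_measurable_cst c : bounded_measurable (fun=> c).
Proof. by split=> //; exists `|c|. Qed.

Lemma bounded_measurableD f g : bounded_measurable f -> bounded_measurable g ->
  bounded_measurable (fun w => f w + g w).
Proof.
move=> [mf [C fC]] [mg [D gD]]; split; first exact: measurable_funD.
by exists (C + D) => w; rewrite (le_trans (ler_normD _ _))// lerD.
Qed.

Lemma bounded_measurableM f g : bounded_measurable f -> bounded_measurable g ->
  bounded_measurable (fun w => f w * g w).
Proof.
move=> [mf [C fC]] [mg [D gD]]; split; first exact: measurable_funM.
by exists (C * D) => w; rewrite normrM ler_pM.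
Qed.

Lemma bounded_measurableB f g : bounded_measurable f -> bounded_measurable g ->
  bounded_measurable (fun w => f w - g w).
Proof.
move=> bf bg; apply: bounded_measurableD => //.
under eq_fun do rewrite -mulN1r.
exact: bounded_measurableM (bounded_measurable_cst _) bg.
Qed.

Lemma bounded_measurable_sum (I : Type) (s : seq I) (f : I -> T -> R) :
  (forall i, bounded_measurable (f i)) ->
  bounded_measurable (fun w => \sum_(i <- s) f i w).
Proof.
move=> bf; elim: s => [|i s IH].
  by under eq_fun do rewrite big_nil; exact: bounded_measurable_cst.
by under eq_fun do rewrite big_cons; exact: bounded_measurableD.
Qed.

Lemma bounded_measurable_indic (A : set T) : measurable A ->
  bounded_measurable (\1_A : T -> R).
Proof.
move=> mA; split; first exact: measurable_indic.
by exists 1 => w; rewrite indicE ger0_norm// lern1 leq_b1.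
Qed.

Lemma bounded_measurable_integrable f : bounded_measurable f ->
  P.-integrable setT (EFin \o f).
Proof.
move=> [mf [C fC]]; apply: measurable_bounded_integrable => //.
  by apply: (le_lt_trans (probability_le1 P measurableT)); rewrite ltry.
exists C; split; first exact: num_real.
by move=> M CM w _ /=; rewrite (le_trans (fC w))// ltW.
Qed.

Local Notation E f := (Rintegral P setT f).

Lemma EFin_mean f : bounded_measurable f -> (\int[P]_w (f w)%:E = (E f)%:E)%E.
Proof.
move=> /bounded_measurable_integrable /integrable_fin_num ff.
by rewrite /Rintegral fineK// ff.
Qed.

Lemma meanD f g : bounded_measurable f -> bounded_measurable g ->
  E (fun w => f w + g w) = E f + E g.
Proof.
by move=> bf bg; rewrite RintegralD//; exact: bounded_measurable_integrable.
Qed.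

Lemma meanB f g : bounded_measurable f -> bounded_measurable g ->
  E (fun w => f w - g w) = E f - E g.
Proof.
by move=> bf bg; rewrite RintegralB//; exact: bounded_measurable_integrable.
Qed.

Lemma meanZ c f : bounded_measurable f -> E (fun w => c * f w) = c * E f.
Proof.
by move=> bf; rewrite RintegralZl//; exact: bounded_measurable_integrable.
Qed.

Lemma mean_cst c : E (fun=> c) = c.
Proof.
rewrite Rintegral_cst// -[RHS]mulr1; congr (_ * _).
exact: (congr1 fine (probability_setT P)).
Qed.

Lemma mean_sum (I : Type) (s : seq I) (f : I -> T -> R) :
  (forall i, bounded_measurable (f i)) ->
  E (fun w => \sum_(i <- s) f i w) = \sum_(i <- s) E (f i).
Proof.
move=> bf; elim: s => [|i s IH].
  rewrite big_nil -[RHS](mean_cst 0).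
  by congr Rintegral; apply/funext => w; rewrite big_nil.
rewrite big_cons -IH -meanD//; last exact: bounded_measurable_sum.
by congr Rintegral; apply/funext => w; rewrite big_cons.
Qed.

Lemma mean_le f g : bounded_measurable f -> bounded_measurable g ->
  (forall w, f w <= g w) -> E f <= E g.
Proof.
move=> bf bg fg; apply: le_Rintegral => //; exact: bounded_measurable_integrable.
Qed.

Lemma mean_ge0 f : (forall w, 0 <= f w) -> 0 <= E f.
Proof. by move=> f0; exact: Rintegral_ge0. Qed.

(** Nonnegativity of the variance, with the square around the mean [m] expanded. *)
Lemma sqr_mean_le f : bounded_measurable f -> E f ^+ 2 <= E (fun w => f w ^+ 2).
Proof.
move=> bf; set m := E f.
have bf2 : bounded_measurable (fun w => f w ^+ 2) := bounded_measurableM bf bf.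
have bmf : bounded_measurable (fun w => 2 * m * f w).
  exact: bounded_measurableM (bounded_measurable_cst _) bf.
have : 0 <= E (fun w => (f w ^+ 2 - 2 * m * f w) + m ^+ 2).
  apply: mean_ge0 => w; have := sqr_ge0 (f w - m); rewrite sqrrB.
  by rewrite mulrC mulr_natl mulrnAl.
rewrite meanD//; last 2 first.
  exact: bounded_measurableB.
  exact: bounded_measurable_cst.
rewrite meanB// meanZ// mean_cst -/m => h; rewrite -subr_ge0.
by move: h; congr (is_true (0 <= _)); ring.
Qed.

Lemma integral_in_mean (A : set T) f : measurable A -> bounded_measurable f ->
  (\int[P]_(w in A) (f w)%:E = (E (fun w => \1_A w * f w))%:E)%E.
Proof.
move=> mA bf; rewrite -EFin_mean; last first.
  exact: bounded_measurableM (bounded_measurable_indic mA) bf.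
rewrite integral_mkcond; apply: eq_integral => w _.
by rewrite patchE indicE; case: ifPn => _; rewrite ?mul1r ?mul0r.
Qed.

End bounded_measurable.

(** * Independence *)

Section freezing.
Context (R : realType) d1 d2 d3 (T : measurableType d1) (U : measurableType d2)
  (W : measurableType d3).
Variables (P : probability T R) (Q : probability W R).

(** Tonelli gives measurability of the section integrals of the positive and negative parts; the
    section mean is [fine] of their difference. *)
Lemma measurable_section_mean (h : U * W -> R) : measurable_fun setT h ->
  measurable_fun setT (fun y => \int[Q]_v h (y, v)).
Proof.
move=> mh; pose f := (EFin \o h).
have mf : measurable_fun setT f by exact/measurable_EFinP.
apply: (measurableT_comp (f := fine)) => //.
rewrite (_ : (fun _ => _) =
    (fun y => \int[Q]_v f^\+ (y, v) - \int[Q]_v f^\- (y, v))%E).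
  apply: emeasurable_funB.
  - apply: (measurable_fun_fubini_tonelli_F f^\+%E) => //.
    exact: measurable_funepos.
  - apply: (measurable_fun_fubini_tonelli_F f^\-%E) => //.
    exact: measurable_funeneg.
apply/funext => y; rewrite [LHS]integralE.
under eq_integral do rewrite (funepos_comp f)/=.
by under [X in (_ - X = _)%E]eq_integral do rewrite (funeneg_comp f)/=.
Qed.

Variables (Y : T -> U) (V : T -> W).
Hypotheses (mY : measurable_fun setT Y) (mV : measurable_fun setT V).
Hypothesis YV_indep : forall A B, measurable A -> measurable B ->
  P (Y @^-1` A `&` V @^-1` B) = (P (Y @^-1` A) * Q B)%E.

Let mfY : {mfun T >-> U} := HB.pack Y (isMeasurableFun.Build _ _ _ _ _ mY).
Let mYV : measurable_fun setT (fun w => (Y w, V w)).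
Proof. exact: measurable_fun_pair. Qed.
Let mfYV : {mfun T >-> (U * W)%type} := HB.pack (fun w => (Y w, V w))
  (isMeasurableFun.Build _ _ _ _ _ mYV).

(** By independence the law of [(Y, V)] agrees on rectangles with the product of the law of [Y] and
    [Q], hence everywhere; a change of variables and Fubini then give the identity. *)
Let freezing_bounded (h : U * W -> R) : bounded_measurable h ->
  \int[P]_w h (Y w, V w) = \int[P]_w \int[Q]_v h (Y w, v).
Proof.
move=> bh; have mh := bh.1.
have bhy y : bounded_measurable (fun v => h (y, v)).
  split; first exact: measurableT_comp.
  by have [_ [C hC]] := bh; exists C.
pose mu := distribution P mfY.
have lawE A : measurable A -> (mu \x Q)%E A = distribution P mfYV A.
  by move=> mA; apply: product_measure_unique => // B C mB mC; exact: YV_indep.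
congr fine.
transitivity (\int[distribution P mfYV]_z (h z)%:E)%E.
  rewrite integral_pushforward//=.
  - exact/measurable_EFinP.
  - apply: (@bounded_measurable_integrable _ _ _ P (fun w => h (Y w, V w))).
    split; first exact: measurableT_comp.
    by have [_ [C hC]] := bh; exists C.
transitivity (\int[(mu \x Q)%E]_z (h z)%:E)%E.
  by apply: eq_measure_integral => A mA _; exact/esym/lawE.
rewrite -integral12_prod_meas1; last first.
  apply: measurable_bounded_integrable => //.
    have : (distribution P mfYV setT < +oo)%E.
      by rewrite (le_lt_trans (probability_le1 _ measurableT))// ltry.
    by rewrite -(lawE setT measurableT).
  have [_ [C hC]] := bh; exists C; split; first exact: num_real.
  by move=> M CM w _ /=; rewrite (le_trans (hC w))// ltW.
transitivity (\int[mu]_y (\int[Q]_v h (y, v))%:E)%E.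
  by apply: eq_integral => y _; rewrite /fubini_F EFin_mean.
rewrite integral_pushforward//=.
- by apply/measurable_EFinP; exact: measurable_section_mean.
- apply: (@bounded_measurable_integrable _ _ _ P (fun w => \int[Q]_v h (Y w, v))).
  split; first exact: (measurableT_comp (measurable_section_mean mh)).
  have [_ [C hC]] := bh; exists C => w.
  apply: (le_trans (le_normr_Rintegral _ _)) => //.
    exact: bounded_measurable_integrable.
  rewrite -[leRHS](mean_cst Q C); apply: mean_le => //;
    last exact: bounded_measurable_cst.
  split; first by apply: measurableT_comp => //; exact: (bhy _).1.
  by exists C => v; rewrite normr_id.
Qed.

(* [h] need only be bounded along the values of [Y]: truncating it makes it
   bounded, hence integrable, on the whole product. *)
Lemma mean_freezing (h : U * W -> R) : measurable_fun setT h ->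
  (exists C, forall w v, `|h (Y w, v)| <= C) ->
  \int[P]_w h (Y w, V w) = \int[P]_w \int[Q]_v h (Y w, v).
Proof.
move=> mh [C hC]; pose h' z := Num.max (- C) (Num.min C (h z)).
have hE w v : h (Y w, v) = h' (Y w, v).
  have := hC w v; rewrite ler_norml /h' => /andP[h1 h2].
  by rewrite min_r// max_r.
transitivity (\int[P]_w h' (Y w, V w)).
  by apply: eq_Rintegral => w _.
rewrite freezing_bounded.
  by apply: eq_Rintegral => w _; apply: eq_Rintegral => v _; rewrite hE.
split.
  apply: measurable_maxr => //; exact: measurable_minr.
exists `|C| => z; rewrite /h' ler_norml le_max lerN2 ler_norm ge_max ge_min.
by rewrite ler_norm -normrN ler_norm.
Qed.

End freezing.

Section independence.
Context (R : realType) dT (T : measurableType dT) (Pr : probability T R)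
  d (Omega : measurableType d) (P : probability Omega R) (I : eqType)
  (S : I -> T -> Omega).
Hypothesis S_iid : iid_samples Pr P S.

(* A pi-system generating the sigma-algebra of the samples indexed by [J]. *)
Definition sample_cylinders (J : pred I) : set (set T) :=
  [set D | exists L A, [/\ uniq L, {in L, forall j, J j},
     (forall j, measurable (A j)) & D = \bigcap_(j in [set` L]) (S j @^-1` A j)]].

Let mS j B : measurable B -> measurable (S j @^-1` B).
Proof.
have [mSj _ _] := S_iid; rewrite -[_ @^-1` _]setTI.
by move=> mB; exact: mSj.
Qed.

Lemma sample_cylinders_measurable J : sample_cylinders J `<=` measurable.
Proof.
move=> _ [L [A [uL LJ mA ->]]].
by apply: fin_bigcap_measurable => // j _; exact: mS.
Qed.

Lemma sample_cylinders_setI J : setI_closed (sample_cylinders J).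
Proof.
move=> _ _ [L [A [uL LJ mA ->]]] [L' [A' [uL' LJ' mA' ->]]].
(* The two index lists are merged; an index missing from one list contributes the trivial condition
   [setT] on that side. *)
exists (undup (L ++ L')), (fun j => (if j \in L then A j else setT) `&`
  (if j \in L' then A' j else setT)); split.
- exact: undup_uniq.
- by move=> j; rewrite mem_undup mem_cat => /orP[/LJ|/LJ'].
- by move=> j; apply: measurableI; case: ifP.
- apply/seteqP; split=> w /=.
    move=> [h h'] j _; rewrite /preimage/=.
    by split; case: ifPn => // jL; [exact: h|exact: h'].
  move=> h; split=> j /= jL.
    by have [] := h j; rewrite /= ?mem_undup ?mem_cat jL.
  by have [] := h j; rewrite /= ?mem_undup ?mem_cat jL ?orbT.
Qed.

Lemma sample_cylinders1 (J : pred I) j B : J j -> measurable B ->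
  sample_cylinders J (S j @^-1` B).
Proof.
move=> Jj mB; exists [:: j], (fun=> B); split=> //.
- by move=> i; rewrite inE => /eqP ->.
- apply/seteqP; split=> w /= h; last by apply: h; rewrite /= inE.
  by move=> i /=; rewrite inE => /eqP ->.
Qed.

(** Mutual independence speaks of finitely many samples; here it is extended to every event
    determined by the samples in [J]. *)
Lemma sample_past_indep (J : pred I) j0 D B : ~~ J j0 ->
  <<s sample_cylinders J >> D -> measurable B ->
  Pr (D `&` S j0 @^-1` B) = (Pr D * P B)%E.
Proof.
have [_ lawS indS] := S_iid.
move=> j0J GD mB; pose p : {nonneg R} := NngNum (fine_ge0 (measure_ge0 P B)).
have PB : P B = (p%:num)%:E by rewrite /= fineK// fin_num_measure.
rewrite PB muleC.
(* As functions of [D], both sides are finite measures; they agree on the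
   pi-system of cylinders. *)
apply: (@g_sigma_algebra_measure_unique _ R T (sample_cylinders J)
  (@sample_cylinders_measurable J) (fun=> setT) _ _
  (mrestr Pr (mS j0 mB)) (mscale p Pr)) => //.
- move=> _; exists [::], (fun=> setT); split=> //.
  by rewrite set_nil bigcap_set0.
- by rewrite bigcup_const.
- exact: sample_cylinders_setI.
- move=> _ [L [A [uL LJ mA ->]]].
  have j0L : j0 \notin L by apply/negP => /LJ; exact/negP.
  transitivity (P B * Pr (\bigcap_(j in [set` L]) (S j @^-1` A j)))%E;
    last by rewrite PB.
  (* Placing [B] at [j0] makes the intersection a cylinder over [j0 :: L], to which mutual
     independence applies. *)
  pose A' j := if j == j0 then B else A j.
  have A'L j : j \in L -> A' j = A j.
    by move=> jL; rewrite /A'; case: eqP => // jj; rewrite -jj jL in j0L.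
  transitivity (Pr (\bigcap_(j in [set` (j0 :: L)]) (S j @^-1` A' j))).
    congr (Pr _); apply/seteqP; split=> w /=.
      move=> [h hB] j /=; rewrite inE => /predU1P[->|jL].
        by rewrite /preimage /A' eqxx.
      by rewrite /preimage/= A'L//; exact: h.
    move=> h; split=> [j /= jL|].
      by have := h j; rewrite /preimage /= inE jL orbT A'L//; exact.
    by have := h j0; rewrite /preimage /= inE eqxx /A' eqxx; exact.
  rewrite (indS (j0 :: L) A'); last 2 first.
    by rewrite /= j0L.
    by move=> j; rewrite /A'; case: eqP.
  rewrite big_cons lawS; last by rewrite /A' eqxx.
  rewrite (indS L A)//; congr (_ * _)%E; first by rewrite /A' eqxx.
  by apply: eq_big_seq => j jL; rewrite A'L.
- move=> _; apply: (@le_lt_trans _ _ 1%E); last exact: ltry.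
  by apply: (probability_le1 Pr); apply: measurableI => //; exact: mS.
Qed.

End independence.

(** * Bounded random vectors *)

Section bounded_vectors.
Context (R : realType) (n : nat) d (T : measurableType d).

Lemma normr_dotv_le (x y : 'rV[R]_n) : `|dotv x y| <= sqn x + sqn y.
Proof.
have := sqn_ge0 (x - y); have := sqn_ge0 (x + y).
rewrite /sqn !dotvE (dotvC y x) ler_norml => h1 h2.
have := sqn_ge0 x; have := sqn_ge0 y; rewrite /sqn => h3 h4.
by apply/andP; split; lra.
Qed.

Lemma bounded_measurable_coord (f : T -> 'rV[R]_n) i :
  measurable_fun setT (f : T -> borel_rV R n) ->
  (exists C, forall w, sqn (f w) <= C) ->
  bounded_measurable (fun w => f w 0 i).
Proof.
move=> mf [C fC]; split; first exact: (measurableT_comp (measurable_coord i) mf).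
exists (1 + C) => w; have := le_trans (coord_sqr_le (f w) i) (fC w).
rewrite -real_normK ?num_real//; move: `|_| => t tC.
have := sqr_ge0 (t - 1); have := sqr_ge0 t; rewrite sqrrB expr1n mulr1.
move=> ? ?; lra.
Qed.

Lemma bounded_measurable_dotv (f g : T -> 'rV[R]_n) :
  measurable_fun setT (f : T -> borel_rV R n) ->
  (exists C, forall w, sqn (f w) <= C) ->
  measurable_fun setT (g : T -> borel_rV R n) ->
  (exists C, forall w, sqn (g w) <= C) ->
  bounded_measurable (fun w => dotv (f w) (g w)).
Proof.
move=> mf [C fC] mg [D gD]; split; first exact: measurable_dotv.
by exists (C + D) => w; rewrite (le_trans (normr_dotv_le _ _))// lerD.
Qed.

End bounded_vectors.

(** * The mean residual *)

Section mean_residual.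
Context (R : realType) (n : nat) (X : set 'rV[R]_n) (X0 : X !=set0).
Context d (Omega : measurableType d) (P : probability Omega R)
  (XS : Omega -> set 'rV[R]_n).
Hypotheses (XSclosed : forall s, closed (XS s))
  (XSconvex : forall s, convex_set (XS s)) (XsubXS : forall s, X `<=` XS s).
Hypothesis proj_meas : measurable_fun setT
  ((fun p => proj (XS p.1) p.2) : Omega * borel_rV R n -> borel_rV R n).
Implicit Types (x y z : 'rV[R]_n).

Definition residual (x : 'rV[R]_n) (s : Omega) : 'rV[R]_n := x - proj (XS s) x.

Definition mean_residual (x : 'rV[R]_n) : 'rV[R]_n := expect_rV P (residual x).

Let XS0 s : XS s !=set0.
Proof. by have [z Xz] := X0; exists z; exact: XsubXS. Qed.

Lemma residual_dot x z s : X z ->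
  sqn (residual x s) <= dotv (residual x s) (x - z).
Proof. by move=> Xz; apply: proj_dot => //; exact: XsubXS. Qed.

Lemma residual_le x z s : X z -> sqn (residual x s) <= sqn (x - z).
Proof. by move=> Xz; apply: proj_min => //; exact: XsubXS. Qed.

(** The point comes first and the sample second, the order in which the freezing lemma integrates
    out the sample. *)
Lemma measurable_residual : measurable_fun setT
  ((fun p => residual p.1 p.2) : borel_rV R n * Omega -> borel_rV R n).
Proof.
apply: measurable_subv; first exact: measurable_fst.
exact: (measurableT_comp proj_meas (@measurable_swap _ _ (borel_rV R n) Omega)).
Qed.

Lemma measurable_residual_comp d' (T : measurableType d')
    (f : T -> 'rV[R]_n) (g : T -> Omega) :
  measurable_fun setT (f : T -> borel_rV R n) -> measurable_fun setT g ->
  measurable_fun setT ((fun w => residual (f w) (g w)) : T -> borel_rV R n).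
Proof.
move=> mf mg.
exact: (measurableT_comp measurable_residual (measurable_fun_pair mf mg)).
Qed.

Lemma residual_measurable x :
  measurable_fun setT (residual x : Omega -> borel_rV R n).
Proof. exact: measurable_residual_comp. Qed.

Lemma residual_bounded x : exists C, forall s, sqn (residual x s) <= C.
Proof. by have [z Xz] := X0; exists (sqn (x - z)) => s; exact: residual_le. Qed.

Let bm_coord x i : bounded_measurable (fun s => residual x s 0 i).
Proof.
apply: bounded_measurable_coord; first exact: residual_measurable.
exact: residual_bounded.
Qed.

Let bm_sqn x : bounded_measurable (fun s => sqn (residual x s)).
Proof.
by apply: bounded_measurable_dotv; try exact: residual_measurable;
  exact: residual_bounded.
Qed.

Lemma mean_sqdistE x : mean_sqdist P XS x = \int[P]_s sqn (residual x s).
Proof.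
rewrite /mean_sqdist unlock.
by apply: eq_Rintegral => s _; rewrite enorm_sqr.
Qed.

Lemma mean_residualE x i : mean_residual x 0 i = \int[P]_s residual x s 0 i.
Proof. by rewrite mxE unlock. Qed.

Lemma mean_residual_dot x y :
  dotv (mean_residual x) y = \int[P]_s dotv (residual x s) y.
Proof.
rewrite mean_sum => [|i].
  apply: eq_bigr => i _; rewrite mean_residualE mulrC -meanZ//.
  by apply: eq_Rintegral => s _; rewrite mulrC.
exact: bounded_measurableM (bm_coord x i) (bounded_measurable_cst _ _).
Qed.

Lemma mean_sqdist_le_dot x z : X z ->
  mean_sqdist P XS x <= dotv (mean_residual x) (x - z).
Proof.
move=> Xz; rewrite mean_sqdistE mean_residual_dot; apply: mean_le => //.
  apply: bounded_measurable_dotv.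
  - exact: residual_measurable.
  - exact: residual_bounded.
  - exact: measurable_cst.
  - by exists (sqn (x - z)).
by move=> s; exact: residual_dot.
Qed.

(** Jensen's inequality, coordinate by coordinate; it shows that 1 is an admissible value of
    [gamma]. *)
Lemma sqn_mean_residual_le x : sqn (mean_residual x) <= mean_sqdist P XS x.
Proof.
rewrite mean_sqdistE mean_sum => [|i]; last exact: bounded_measurableM.
apply: ler_sum => i _; rewrite mean_residualE -expr2.
exact: sqr_mean_le.
Qed.

Lemma mean_sqdist_ge0 x : 0 <= mean_sqdist P XS x.
Proof. by rewrite mean_sqdistE; apply: mean_ge0 => s; exact: sqn_ge0. Qed.

Lemma mean_sqdist_le x z : X z -> mean_sqdist P XS x <= sqn (x - z).
Proof.
move=> Xz; rewrite mean_sqdistE -[leRHS](mean_cst P); apply: mean_le => //.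
  exact: bounded_measurable_cst.
by move=> s; exact: residual_le.
Qed.

(** The average of [sqdist_le]: it passes smallness of the mean squared distance from the iterates
    to a cluster point. *)
Lemma mean_sqdist_perturb x y :
  mean_sqdist P XS y <= 2 * mean_sqdist P XS x + 2 * sqn (y - x).
Proof.
rewrite !mean_sqdistE -meanZ// -[X in _ + X](mean_cst P) -meanD; last 2 first.
  exact: bounded_measurableM (bounded_measurable_cst _ _) (bm_sqn x).
  exact: bounded_measurable_cst.
apply: mean_le => //.
  apply: bounded_measurableD; last exact: bounded_measurable_cst.
  exact: bounded_measurableM (bounded_measurable_cst _ _) (bm_sqn x).
by move=> s; exact: sqdist_le.
Qed.

(** A nonnegative function with zero integral vanishes almost everywhere, and a residual vanishes
    exactly at the points of its set. *)
Lemma mean_sqdist_eq0 y : mean_sqdist P XS y = 0 -> P [set s | XS s y] = 1%E.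
Proof.
move=> M0; have msq := (bm_sqn y).1.
have : (\int[P]_s `|(sqn (residual y s))%:E| = 0)%E.
  transitivity (\int[P]_s (sqn (residual y s))%:E)%E.
    by apply: eq_integral => s _; rewrite gee0_abs// lee_fin sqn_ge0.
  by rewrite EFin_mean// -mean_sqdistE M0.
have -> : [set s | XS s y] = [set s | sqn (residual y s) = 0].
  by apply/seteqP; split=> s /=; rewrite sqdist_eq0.
have mE : measurable [set s | sqn (residual y s) = 0].
  rewrite -[X in measurable X]setTI; exact: (msq measurableT [set 0]).
move=> /ae_eq_integral_abs []//; first exact/measurable_EFinP.
move=> N [mN PN sN].
rewrite -[X in P X]setCK probability_setC; last exact: measurableC.
rewrite (@subset_measure0 _ _ _ _ _ N) ?sube0//; first exact: measurableC.
apply: subset_trans sN => s /= sy; apply: contra_not sy => /(_ I).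
by move=> -[].
Qed.

Lemma measurable_mean_sqdist : measurable_fun setT
  (mean_sqdist P XS : borel_rV R n -> R).
Proof.
rewrite (_ : mean_sqdist P XS = fun x => \int[P]_s sqn (residual x s)); last first.
  by apply/funext => x; rewrite mean_sqdistE.
apply: (@measurable_section_mean _ _ _ (borel_rV R n) Omega P
  (fun p => sqn (residual p.1 p.2))).
by apply: measurable_dotv; exact: measurable_residual.
Qed.

Lemma measurable_mean_residual : measurable_fun setT
  (mean_residual : borel_rV R n -> borel_rV R n).
Proof.
apply: measurable_rV => i; under eq_fun do rewrite mean_residualE.
apply: (@measurable_section_mean _ _ _ (borel_rV R n) Omega P
  (fun p => residual p.1 p.2 0 i)).
exact: (measurableT_comp (measurable_coord i) measurable_residual).
Qed.

End mean_residual.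

(** * Almost sure summability, versions of conditional expectations, measurable limits *)

Section almost_sure.
Context (R : realType) d (T : measurableType d) (P : probability T R).

(** By monotone convergence the total sum has integral at most [C], so it is finite almost
    everywhere. *)
Lemma ae_cvg_series (h : nat -> T -> R) (C : R) :
  (forall k, bounded_measurable (h k)) -> (forall k w, 0 <= h k w) ->
  (forall K, \sum_(k < K) \int[P]_w h k w <= C) ->
  {ae P, forall w, cvgn (series (h ^~ w))}.
Proof.
move=> bh h0 hC; pose f w := (\sum_(k <oo) (h k w)%:E)%E.
have h0e k w : (0 <= (h k w)%:E)%E by rewrite lee_fin.
have mh k : measurable_fun setT (fun w => (h k w)%:E).
  by apply/measurable_EFinP; exact: (bh k).1.
have f0 w : (0 <= f w)%E by apply: nneseries_ge0.
have intf : P.-integrable setT f.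
  apply/integrableP; split; first exact: ge0_emeasurable_sum.
  under eq_integral do rewrite gee0_abs//.
  rewrite integral_nneseries//; apply: (@le_lt_trans _ _ C%:E); last exact: ltry.
  apply: lime_le; first by apply: is_cvg_nneseries => k _ _; exact: integral_ge0.
  apply: nearW => K; under eq_bigr do rewrite EFin_mean//.
  by rewrite big_mkord sumEFin lee_fin.
apply: filterS (integrable_ae measurableT intf) => w /(_ I) fw.
apply: nondecreasing_is_cvgn; first by move=> i j; apply: nondecreasing_series.
exists (fine (f w)) => _ [K _ <-].
rewrite -lee_fin fineK// /series/= -sumEFin; exact: nneseries_lim_ge.
Qed.

(** Uniqueness of versions, in one-sided form: the event [Z' < Z] belongs to [G], so both versions
    have the same integral over it, which forces it to be null. A bound proved for one explicit
    version then holds for all. *)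
Lemma cond_expectation_le (G : set (set T)) (Y Z Z' : T -> R) :
  sigma_algebra setT G ->
  is_cond_expectation P G Y Z -> is_cond_expectation P G Y Z' ->
  {ae P, forall w, Z w <= Z' w}.
Proof.
move=> sG [Gm _ iZ GZ EZ] [_ _ iZ' GZ' EZ'].
have mG (W : T -> R) : (forall B, measurable B -> G (W @^-1` B)) ->
    measurable_fun setT (W : g_sigma_algebraType G -> R).
  by move=> GW _ B mB; rewrite setTI; apply: sub_sigma_algebra; exact: GW.
pose A := [set w | Z' w < Z w].
have GA : G A.
  have := @measurable_fun_ltr _ (g_sigma_algebraType G) R setT _ _
    (mG _ GZ') (mG _ GZ).
  move=> /(_ measurableT [set true] I); rewrite setTI.
  rewrite /measurable/= sigma_algebra_id//; congr G.
have mA : measurable A := Gm _ GA.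
have iZA : P.-integrable A (EFin \o Z) by exact: integrableS iZ.
have iZA' : P.-integrable A (EFin \o Z') by exact: integrableS iZ'.
have : (\int[P]_(w in A) `|(Z w - Z' w)%:E| = 0)%E.
  transitivity (\int[P]_(w in A) ((EFin \o Z) \- (EFin \o Z')) w)%E.
    apply: eq_integral => w; rewrite inE => Aw.
    by rewrite gee0_abs// lee_fin subr_ge0 ltW.
  rewrite integralB//= EZ// EZ'// subee//.
  by rewrite -EZ'//; exact: integrable_fin_num.
move=> /ae_eq_integral_abs []//.
  apply/measurable_EFinP; apply: measurable_funB; apply/measurable_EFinP.
    exact: measurable_int iZA.
  exact: measurable_int iZA'.
(* Outside the null set [N], having [Z' w < Z w] would force [Z w = Z' w]. *)
move=> N [mN PN AN]; exists N; split=> // w /= Zw; apply: AN => /= h.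
apply: Zw; rewrite leNgt; apply/negP => Aw.
have [/eqP] := h Aw; rewrite subr_eq0 => /eqP ZZ.
by rewrite ZZ ltxx in Aw.
Qed.

Lemma measurable_limit n (u : nat -> T -> 'rV[R]_n) :
  (forall k, measurable_fun setT (u k : T -> borel_rV R n)) ->
  exists2 v : T -> 'rV[R]_n, measurable_fun setT (v : T -> borel_rV R n) &
    forall w y, u k w @[k --> \oo] --> y -> v w = y.
Proof.
move=> mu.
(* A limsup is measurable even where the sequence diverges. *)
exists (fun w => \row_i fine (limn_esup (fun k => (u k w 0 i)%:E))).
  apply: measurable_rV => i; under eq_fun do rewrite mxE.
  apply: (measurableT_comp (f := fine)) => //.
  apply: measurable_fun_limn_esup => k; apply/measurable_EFinP.
  exact: (measurableT_comp (measurable_coord i) (mu k)).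
move=> w y uy; apply/rowP => i; rewrite mxE.
have ui : u k w 0 i @[k --> \oo] --> y 0 i.
  exact: (@continuous_cvg nat 'rV[R]_n R (nbhs \oo) _ (u ^~ w)
    (fun M : 'rV[R]_n => M 0 i) y (@coord_continuous R 1 n 0 i y) uy).
have uiE : (u k w 0 i)%:E @[k --> \oo] --> (y 0 i)%:E.
  by apply/fine_cvgP; split => //=; apply: nearW.
rewrite is_cvg_limn_esupE; last exact: cvgP uiE.
by rewrite (cvg_lim _ uiE)//.
Qed.

End almost_sure.

(** * The random iterates *)

Section iterates.
Context (R : realType) (n : nat) (X : set 'rV[R]_n) (X0 : X !=set0).
Context d (Omega : measurableType d) (P : probability Omega R)
  (XS : Omega -> set 'rV[R]_n).
Hypotheses (XSclosed : forall s, closed (XS s))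
  (XSconvex : forall s, convex_set (XS s)) (XsubXS : forall s, X `<=` XS s).
Hypothesis proj_meas : measurable_fun setT
  ((fun p => proj (XS p.1) p.2) : Omega * borel_rV R n -> borel_rV R n).
Context (N : nat) (N0 : (0 < N)%N).
Context (x0 : 'rV[R]_n) (alpha : nat -> R).

Let XS0 s : XS s !=set0.
Proof. by have [z Xz] := X0; exists z; exact: XsubXS. Qed.

Local Notation res := (residual XS).
Local Notation M := (mean_sqdist P XS).
Local Notation m := (mean_residual P XS).

Let res_dot x z s : X z -> sqn (res x s) <= dotv (res x s) (x - z).
Proof. exact: residual_dot. Qed.

Let res_le x z s : X z -> sqn (res x s) <= sqn (x - z).
Proof. exact: residual_le. Qed.

Let measurable_res y : measurable_fun setT (res y : Omega -> borel_rV R n).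
Proof. exact: residual_measurable. Qed.

Let bounded_res y : exists C, forall s, sqn (res y s) <= C.
Proof. exact: (residual_bounded X0). Qed.

Lemma spaS (T : Type) (S : nat * 'I_N -> T -> Omega) k w :
  let x := spa XS x0 alpha S in
  x k.+1 w = x k w - alpha k *: (N%:R^-1 *: \sum_i res (x k w) (S (k, i) w)).
Proof.
rewrite /=; set x := spa XS x0 alpha S k w; congr (_ - _ *: _).
rewrite sumrB sumr_const card_ord scalerBr; congr (_ - _).
by rewrite -[x *+ N]scaler_nat scalerA mulVf ?scale1r// pnatr_eq0 -lt0n.
Qed.

(** Only samples of iterations before [k] enter. The sigma-algebra on [T] is arbitrary, so it can be
    taken to be the one generated by the past samples. *)
Lemma measurable_spa d' (T : measurableType d') (S : nat * 'I_N -> T -> Omega) k :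
  (forall j, (j.1 < k)%N -> measurable_fun setT (S j)) ->
  measurable_fun setT (spa XS x0 alpha S k : T -> borel_rV R n).
Proof.
elim: k => [|k IH] mS; first exact: measurable_cst.
have mk := IH (fun j jk => mS j (ltnW jk)).
rewrite (_ : spa _ _ _ _ k.+1 = fun w => spa XS x0 alpha S k w -
  alpha k *: (N%:R^-1 *: \sum_i res (spa XS x0 alpha S k w) (S (k, i) w))).
  apply: measurable_subv => //; apply: measurable_scalev; apply: measurable_scalev.
  apply: measurable_sumv => i; apply: measurable_residual_comp => //.
  exact: mS.
by apply/funext => w; rewrite spaS.
Qed.

Context dT (T : measurableType dT) (Pr : probability T R).
Variable S : nat * 'I_N -> T -> Omega.
Local Notation x := (spa XS x0 alpha S).
Local Notation r k i := (fun w => res (x k w) (S (k, i) w)).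

Lemma sqn_spaS z k w : sqn (x k.+1 w - z) =
  sqn (x k w - z) - 2 * alpha k * (N%:R^-1 * \sum_i dotv (r k i w) (x k w - z)) +
  alpha k ^+ 2 * (N%:R^-1 ^+ 2 * \sum_i \sum_j dotv (r k i w) (r k j w)).
Proof. by rewrite spaS sqn_step. Qed.

Lemma sqn_spaS_le z k w : X z -> 0 <= alpha k ->
  sqn (x k.+1 w - z) <=
  sqn (x k w - z) + alpha k ^+ 2 * (N%:R^-1 * \sum_i sqn (r k i w)).
Proof.
move=> Xz a0; rewrite spaS; apply: sqn_step_le => // i.
exact: le_trans (sqn_ge0 _) (res_dot _ _ Xz).
Qed.

Hypothesis alpha_ge0 : forall k, 0 <= alpha k.

(** The start is deterministic and no residual exceeds the distance to [z], so one step multiplies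
    the bound by at most [1 + alpha k ^+ 2]. *)
Lemma spa_bounded z k : X z -> exists C, forall w, sqn (x k w - z) <= C.
Proof.
move=> Xz; elim: k => [|k [C IH]]; first by exists (sqn (x0 - z)).
exists (C + alpha k ^+ 2 * (N%:R^-1 * (N%:R * C))) => w.
apply: (le_trans (sqn_spaS_le _ Xz (alpha_ge0 k))); apply: lerD => //.
apply: ler_wpM2l; first exact: sqr_ge0.
apply: ler_wpM2l; first by rewrite invr_ge0.
rewrite mulr_natl -[X in _ *+ X](card_ord N) -sumr_const.
apply: ler_sum => i _; apply: le_trans (IH w).
exact: res_le.
Qed.

Hypothesis S_iid : iid_samples Pr P S.

Let mS j : measurable_fun setT (S j).
Proof. by have [h _ _] := S_iid; exact: h. Qed.

Lemma measurable_iterate k : measurable_fun setT (x k : T -> borel_rV R n).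
Proof. by apply: measurable_spa. Qed.

Let mx := measurable_iterate.

Let measurable_x_past (J : pred (nat * 'I_N)) k :
  (forall j, (j.1 < k)%N -> J j) ->
  measurable_fun setT (x k :
    g_sigma_algebraType (sample_cylinders S J) -> borel_rV R n).
Proof.
move=> kJ; apply: measurable_spa => j /kJ Jj _ B mB; rewrite setTI.
by apply: sub_sigma_algebra; exact: sample_cylinders1.
Qed.

(** The freezing lemma for a sample [j0] outside [J] and a variable [Y] determined by the samples in
    [J]. *)
Let freezing d2 (U : measurableType d2) (J : pred (nat * 'I_N)) j0
    (Y : T -> U) (h : U * Omega -> R) :
  ~~ J j0 ->
  measurable_fun setT (Y : g_sigma_algebraType (sample_cylinders S J) -> U) ->
  measurable_fun setT h -> (exists C, forall w v, `|h (Y w, v)| <= C) ->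
  \int[Pr]_w h (Y w, S j0 w) = \int[Pr]_w \int[P]_v h (Y w, v).
Proof.
move=> Jj0 mY mh bh; apply: mean_freezing; [|by []| |by []|by []].
  move=> _ B mB; have := mY measurableT B mB; rewrite !setTI => YB.
  have : sigma_algebra setT (@measurable _ T) by exact: sigma_algebra_measurable.
  move=> /smallest_sub; apply; last exact: YB.
  exact: (sample_cylinders_measurable S_iid).
move=> A B mA mB; apply: (sample_past_indep S_iid Jj0) => //.
by have := mY measurableT A mA; rewrite setTI.
Qed.

(** * Moments of the fresh residuals, tested on events of the current iterate *)

Section conditional_means.
Variables (k : nat) (A : set 'rV[R]_n).
Hypothesis mA : measurable (A : set (borel_rV R n)).
Local Notation cA w := (\1_A (x k w) : R).

Let m1A : measurable_fun setT (\1_A : borel_rV R n -> R).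
Proof. exact: measurable_indic. Qed.

Let c01 y : `|\1_A y : R| <= 1.
Proof. by rewrite indicE ger0_norm// lern1 leq_b1. Qed.

Let bound_dot (a b : 'rV[R]_n) c y : sqn a + sqn b <= c ->
  `|(\1_A y : R) * dotv a b| <= c.
Proof.
move=> abc; rewrite normrM -[leRHS]mul1r ler_pM//.
exact: le_trans (normr_dotv_le _ _) abc.
Qed.

Let past_k (j : nat * 'I_N) := (j.1 < k)%N.

(** The fresh sample is integrated out with [x k] frozen. The map [g] is later [y - z] for the
    linear term and [m] for products of two residuals; the indicator of [A] supplies the tests that
    define a conditional expectation. *)
Lemma mean_residual_cross i (g : 'rV[R]_n -> 'rV[R]_n) :
  measurable_fun setT (g : borel_rV R n -> borel_rV R n) ->
  (exists C, forall w, sqn (g (x k w)) <= C) ->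
  \int[Pr]_w (cA w * dotv (r k i w) (g (x k w))) =
  \int[Pr]_w (cA w * dotv (m (x k w)) (g (x k w))).
Proof.
move=> mg [C gC]; have [z Xz] := X0.
have [D xD] := spa_bounded k Xz.
rewrite (@freezing _ (borel_rV R n) past_k (k, i) (x k)
  (fun p => \1_A p.1 * dotv (res p.1 p.2) (g p.1))).
- apply: eq_Rintegral => w _; rewrite /= meanZ.
    by rewrite (mean_residual_dot X0).
  apply: bounded_measurable_dotv.
  + exact: measurable_res.
  + exact: bounded_res.
  + exact: measurable_cst.
  + by exists (sqn (g (x k w))).
- by rewrite /past_k ltnn.
- exact: measurable_x_past.
- apply: measurable_funM; first exact: (measurableT_comp m1A measurable_fst).
  apply: measurable_dotv; first exact: measurable_residual.
  exact: (measurableT_comp mg measurable_fst).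
- exists (D + C) => w v; apply: bound_dot; apply: lerD; last exact: gC.
  exact: le_trans (res_le _ _ Xz) (xD w).
Qed.

Lemma mean_residual_sqr i :
  \int[Pr]_w (cA w * sqn (r k i w)) = \int[Pr]_w (cA w * M (x k w)).
Proof.
have [z Xz] := X0; have [D xD] := spa_bounded k Xz.
rewrite (@freezing _ (borel_rV R n) past_k (k, i) (x k)
  (fun p => \1_A p.1 * sqn (res p.1 p.2))).
- apply: eq_Rintegral => w _; rewrite /= meanZ ?mean_sqdistE//.
  by apply: bounded_measurable_dotv; try exact: measurable_res;
    exact: bounded_res.
- by rewrite /past_k ltnn.
- exact: measurable_x_past.
- apply: measurable_funM; first exact: (measurableT_comp m1A measurable_fst).
  by apply: measurable_dotv; exact: measurable_residual.
- exists (D + D) => w v; apply: bound_dot; apply: lerD => //;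
  exact: le_trans (res_le _ _ Xz) (xD w).
Qed.

Lemma mean_residual_prod i j : i != j ->
  \int[Pr]_w (cA w * dotv (r k i w) (r k j w)) =
  \int[Pr]_w (cA w * sqn (m (x k w))).
Proof.
move=> ij; have [z Xz] := X0; have [D xD] := spa_bounded k Xz.
have rD w v : sqn (res (x k w) v) <= D.
  exact: le_trans (res_le _ _ Xz) (xD w).
(* [J] is the past together with [(k, i)]; since [i != j], the sample [(k, j)] is still fresh. *)
pose J l := past_k l || (l == (k, i)).
transitivity (\int[Pr]_w (cA w * dotv (r k i w) (m (x k w)))); last first.
  apply: mean_residual_cross; first exact: measurable_mean_residual.
  exists D => w.
  have mM : sqn (m (x k w)) <= M (x k w) by exact: (sqn_mean_residual_le X0).
  apply: (le_trans mM).
  apply: le_trans (xD w); exact: (mean_sqdist_le X0).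
(* Integrate out [S (k, j)] first, with [x k] and [S (k, i)] frozen. *)
rewrite (@freezing _ (borel_rV R n * Omega)%type J (k, j)
  (fun w => (x k w, S (k, i) w))
  (fun p => \1_A p.1.1 * dotv (res p.1.1 p.1.2) (res p.1.1 p.2))).
- apply: eq_Rintegral => w _; rewrite /= meanZ; last first.
    apply: bounded_measurable_dotv.
    + exact: measurable_cst.
    + by exists (sqn (r k i w)).
    + exact: measurable_res.
    + exact: bounded_res.
  congr (_ * _); rewrite dotvC (mean_residual_dot X0)//.
  by apply: eq_Rintegral => v _; rewrite dotvC.
- by rewrite /J /past_k ltnn/= xpair_eqE eqxx eq_sym.
- apply: measurable_fun_pair.
    by apply: measurable_x_past => l; rewrite /J /past_k => ->.
  move=> _ B mB; rewrite setTI; apply: sub_sigma_algebra.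
  by apply: sample_cylinders1 => //; rewrite /J eqxx orbT.
- have m11 : measurable_fun setT (fun p : borel_rV R n * Omega * Omega => p.1.1).
    exact: (measurableT_comp measurable_fst measurable_fst).
  apply: measurable_funM; first exact: (measurableT_comp m1A m11).
  apply: measurable_dotv; apply: measurable_residual_comp => //.
  exact: (measurableT_comp measurable_snd measurable_fst).
- by exists (D + D) => w v; apply: bound_dot; apply: lerD; exact: rD.
Qed.

End conditional_means.

(* E[|x k.+1 - z|^2 | x k = y] *)
Definition second_moment k z y : R :=
  sqn (y - z) - 2 * alpha k * dotv (m y) (y - z) +
  alpha k ^+ 2 * (N%:R^-1 * M y + (1 - N%:R^-1) * sqn (m y)).

Let measurable_m : measurable_fun setT (m : borel_rV R n -> borel_rV R n).
Proof. exact: measurable_mean_residual. Qed.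

Let measurable_M : measurable_fun setT (M : borel_rV R n -> R).
Proof. exact: measurable_mean_sqdist. Qed.

Let M_le y z : X z -> M y <= sqn (y - z).
Proof. exact: (mean_sqdist_le X0). Qed.

Let mxB k z : measurable_fun setT ((fun w => x k w - z) : T -> borel_rV R n).
Proof. by apply: measurable_subv; [exact: mx|exact: measurable_cst]. Qed.

Let mr k i : measurable_fun setT (r k i : T -> borel_rV R n).
Proof. by apply: measurable_residual_comp => //; exact: mS. Qed.

Let br k i : exists C, forall w, sqn (r k i w) <= C.
Proof.
have [z Xz] := X0; have [C xC] := spa_bounded k Xz.
by exists C => w; exact: le_trans (res_le _ _ Xz) (xC w).
Qed.

Let mmx k : measurable_fun setT ((fun w => m (x k w)) : T -> borel_rV R n).
Proof. exact: (measurableT_comp measurable_m (mx k)). Qed.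

Let bM k : exists C, forall w, M (x k w) <= C.
Proof.
have [z Xz] := X0; have [C xC] := spa_bounded k Xz.
by exists C => w; exact: le_trans (M_le _ Xz) (xC w).
Qed.

Let bmx k : exists C, forall w, sqn (m (x k w)) <= C.
Proof.
have [C MC] := bM k; exists C => w; apply: le_trans (MC w).
exact: (sqn_mean_residual_le X0).
Qed.

Let bmM k : bounded_measurable (fun w => M (x k w)).
Proof.
split; first exact: (measurableT_comp measurable_M (mx k)).
have [C MC] := bM k; exists C => w; rewrite ger0_norm//.
exact: mean_sqdist_ge0.
Qed.

Lemma bounded_measurable_sqn_iterate k z : X z ->
  bounded_measurable (fun w => sqn (x k w - z)).
Proof. by move=> Xz; apply: bounded_measurable_dotv => //; exact: spa_bounded. Qed.

Lemma bounded_measurable_second_moment k z : X z ->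
  bounded_measurable (fun w => second_moment k z (x k w)).
Proof.
move=> Xz; have bz := spa_bounded k Xz.
apply: bounded_measurableD.
  apply: bounded_measurableB; first exact: bounded_measurable_sqn_iterate.
  apply: bounded_measurableM; first exact: bounded_measurable_cst.
  exact: bounded_measurable_dotv.
apply: bounded_measurableM; first exact: bounded_measurable_cst.
apply: bounded_measurableD; apply: bounded_measurableM;
  try exact: bounded_measurable_cst; first exact: bmM.
exact: bounded_measurable_dotv.
Qed.

(** In the expanded square, the [N] diagonal terms average to [M] and the [N * (N - 1)] off-diagonal
    ones to [sqn m]; dividing by [N ^+ 2] yields the weights [1 / N] and [1 - 1 / N]. *)
Lemma mean_spaS k z (A : set 'rV[R]_n) : X z ->
  measurable (A : set (borel_rV R n)) ->
  \int[Pr]_w ((\1_A (x k w) : R) * sqn (x k.+1 w - z)) =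
  \int[Pr]_w ((\1_A (x k w) : R) * second_moment k z (x k w)).
Proof.
move=> Xz mA; have bz := spa_bounded k Xz.
pose c w : R := \1_A (x k w); set a := alpha k.
have NR : N%:R != 0 :> R by rewrite pnatr_eq0 -lt0n.
have bc : bounded_measurable c.
  split; first exact: (measurableT_comp (@measurable_indic _ _ _ _ _ mA) (mx k)).
  by exists 1 => w; rewrite /c indicE ger0_norm// lern1 leq_b1.
have b0 : bounded_measurable (fun w => c w * sqn (x k w - z)).
  by apply: bounded_measurableM => //; exact: bounded_measurable_sqn_iterate.
have b1 i : bounded_measurable (fun w => c w * dotv (r k i w) (x k w - z)).
  by apply: bounded_measurableM => //; exact: bounded_measurable_dotv.
have b2 i j : bounded_measurable (fun w => c w * dotv (r k i w) (r k j w)).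
  by apply: bounded_measurableM => //; exact: bounded_measurable_dotv.
have b3 : bounded_measurable (fun w => c w * dotv (m (x k w)) (x k w - z)).
  by apply: bounded_measurableM => //; exact: bounded_measurable_dotv.
have b4 : bounded_measurable (fun w => c w * M (x k w)).
  exact: bounded_measurableM.
have b5 : bounded_measurable (fun w => c w * sqn (m (x k w))).
  by apply: bounded_measurableM => //; exact: bounded_measurable_dotv.
have bZ e f : bounded_measurable f -> bounded_measurable (fun w => e * f w : R).
  by move=> bf; apply: bounded_measurableM => //; exact: bounded_measurable_cst.
pose e0 := \int[Pr]_w (c w * sqn (x k w - z)).
pose e3 := \int[Pr]_w (c w * dotv (m (x k w)) (x k w - z)).
pose e4 := \int[Pr]_w (c w * M (x k w)).
pose e5 := \int[Pr]_w (c w * sqn (m (x k w))).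
transitivity (e0 - 2 * a * e3 + a ^+ 2 * (N%:R^-1 * e4 + (1 - N%:R^-1) * e5)).
  transitivity (\int[Pr]_w (c w * sqn (x k w - z) -
      2 * a * N%:R^-1 * \sum_i (c w * dotv (r k i w) (x k w - z)) +
      a ^+ 2 * N%:R^-1 ^+ 2 * \sum_i \sum_j (c w * dotv (r k i w) (r k j w)))).
    apply: eq_Rintegral => w _; rewrite -/(c w) sqn_spaS -mulr_sumr.
    under [X in _ + _ * X]eq_bigr do rewrite -mulr_sumr.
    by rewrite -mulr_sumr -/a; ring.
  have bs1 : bounded_measurable (fun w => \sum_i (c w * dotv (r k i w) (x k w - z))).
    exact: bounded_measurable_sum.
  have bs2 i : bounded_measurable (fun w => \sum_j (c w * dotv (r k i w) (r k j w))).
    exact: bounded_measurable_sum.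
  have bs3 : bounded_measurable (fun w => \sum_i \sum_j (c w * dotv (r k i w) (r k j w))).
    exact: bounded_measurable_sum.
  rewrite meanD; [|by apply: bounded_measurableB; [|exact: bZ]|exact: bZ].
  rewrite meanB; [|by []|exact: bZ].
  rewrite !meanZ// !mean_sum//.
  under [X in _ - _ * X]eq_bigr => i _.
    rewrite (@mean_residual_cross k A mA i (fun y => y - z))//.
      over.
    by apply: measurable_subv; [exact: measurable_id|exact: measurable_cst].
  (* Both cases at once: the off-diagonal value [e5] plus a correction on the diagonal, so the
     double sum is [N ^+ 2 * e5 + N * (e4 - e5)]. *)
  have cross i j : \int[Pr]_w (c w * dotv (r k i w) (r k j w)) =
      e5 + (if j == i then e4 - e5 else 0).
    case: eqVneq => [->|ji].
      by rewrite (mean_residual_sqr k mA) addrCA subrr addr0.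
    by rewrite addr0 (mean_residual_prod k mA)// eq_sym.
  under [X in _ + _ * X]eq_bigr => i _.
    rewrite mean_sum//; under eq_bigr do rewrite cross.
    rewrite big_split /= -big_mkcond big_pred1_eq sumr_const card_ord.
    over.
  rewrite !sumr_const card_ord -/e0 -/e3 -[e5 *+ N]mulr_natl.
  rewrite -[e3 *+ N]mulr_natl -[(_ + (_ - _)) *+ N]mulr_natl.
  by field.
rewrite [RHS](_ : _ = \int[Pr]_w (c w * sqn (x k w - z) -
    2 * a * (c w * dotv (m (x k w)) (x k w - z)) +
    (a ^+ 2 * N%:R^-1 * (c w * M (x k w)) +
     a ^+ 2 * (1 - N%:R^-1) * (c w * sqn (m (x k w)))))); last first.
  by apply: eq_Rintegral => w _; rewrite -/(c w) /second_moment -/a; ring.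
rewrite meanD; last 2 first.
  by apply: bounded_measurableB => //; exact: bZ.
  by apply: bounded_measurableD; exact: bZ.
rewrite meanB//; last exact: bZ.
rewrite meanD; [|exact: bZ|exact: bZ].
by rewrite !meanZ// -/e0 -/e3 -/e4 -/e5; ring.
Qed.


Lemma is_cond_expectation_spaS k z : X z ->
  is_cond_expectation Pr (sigma_generated (x k : T -> borel_rV R n))
    (fun w => enorm (x k.+1 w - z) ^+ 2) (fun w => second_moment k z (x k w)).
Proof.
move=> Xz; have bY : bounded_measurable (fun w => enorm (x k.+1 w - z) ^+ 2).
  under eq_fun do rewrite enorm_sqr.
  exact: bounded_measurable_sqn_iterate.
have bZ := bounded_measurable_second_moment k Xz.
have sG : sigma_generated (x k : T -> borel_rV R n) `<=` measurable.
  by move=> _ [B mB <-]; exact: (mx k).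
split=> //; try exact: bounded_measurable_integrable.
- move=> B mB; exists (second_moment k z @^-1` B); last by rewrite setTI.
  rewrite -[X in measurable X]setTI.
  have mid : measurable_fun setT ((fun y => y - z) : borel_rV R n -> borel_rV R n).
    by apply: measurable_subv; [exact: measurable_id|exact: measurable_cst].
  suff mPhi : measurable_fun setT (second_moment k z : borel_rV R n -> R).
    exact: mPhi.
  apply: measurable_funD.
    apply: measurable_funB; first exact: measurable_dotv.
    by apply: measurable_funM; [exact: measurable_cst|exact: measurable_dotv].
  apply: measurable_funM; first exact: measurable_cst.
  apply: measurable_funD; apply: measurable_funM => //.
  exact: measurable_dotv.
(* The events generated by [x k] are the preimages of Borel sets [A], so the defining identity is
   [mean_spaS]. *)
- move=> _ [A mA <-]; rewrite setTI.
  have mxA : measurable (x k @^-1` A) by rewrite -[_ @^-1` _]setTI; exact: (mx k).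
  rewrite !integral_in_mean//; congr EFin.
  rewrite -[LHS](mean_spaS k Xz mA).
  by apply: eq_Rintegral => w _; rewrite enorm_sqr.
Qed.

(** * Descent inequality and almost sure convergence *)

Section stepsizes.
Variable gamma : R.
Hypothesis gammaP : forall y, sqn (m y) <= gamma * M y.
Local Notation gammaN := (gamma_minibatch N gamma).

(** The inner product is at least [M y] and [sqn (m y)] is at most [gamma * M y]; the quadratic
    coefficients then add up to [gammaN]. *)
Lemma second_moment_le k z y : X z ->
  second_moment k z y <=
  sqn (y - z) - (2 * alpha k - alpha k ^+ 2 * gammaN) * M y.
Proof.
move=> Xz; have := alpha_ge0 k; rewrite /second_moment; set a := alpha k => a0.
have h1 : M y <= dotv (m y) (y - z) by exact: (mean_sqdist_le_dot X0).
have NR : 0 < N%:R :> R by rewrite ltr0n.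
have h2 : a ^+ 2 * (N%:R^-1 * M y + (1 - N%:R^-1) * sqn (m y)) <=
    a ^+ 2 * (gammaN * M y).
  apply: ler_wpM2l; first exact: sqr_ge0.
  rewrite /gamma_minibatch [leRHS]mulrDl lerD2l -mulrA; apply: ler_wpM2l => //.
  by rewrite subr_ge0 invf_le1// ler1n.
have h3 := ler_wpM2l (mulr_ge0 (ler0n R 2) a0) h1.
apply: (le_trans (lerD (lerB (lexx _) h3) h2)).
by rewrite mulrBl opprB -addrA mulrA [- _ + _]addrC.
Qed.

Lemma sum_mean_sqdist_le (c : R) z K : X z ->
  (forall k, c <= 2 * alpha k - alpha k ^+ 2 * gammaN) ->
  c * \sum_(k < K) \int[Pr]_w M (x k w) <= sqn (x0 - z).
Proof.
move=> Xz ca.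
have step k : \int[Pr]_w sqn (x k.+1 w - z) <=
    \int[Pr]_w sqn (x k w - z) - c * \int[Pr]_w M (x k w).
  have := mean_spaS k Xz measurableT.
  rewrite indicT; under eq_Rintegral do rewrite mul1r.
  under [RHS]eq_Rintegral do rewrite mul1r.
  move=> ->.
  have bcM : bounded_measurable (fun w => c * M (x k w)).
    by apply: bounded_measurableM => //; exact: bounded_measurable_cst.
  have bs := bounded_measurable_sqn_iterate k Xz.
  rewrite -meanZ// -meanB//; apply: mean_le.
  - exact: bounded_measurable_second_moment.
  - exact: bounded_measurableB.
  - move=> w; apply: (le_trans (second_moment_le _ _ Xz)).
    by rewrite lerD2l lerN2 ler_wpM2r ?mean_sqdist_ge0.
(* The expected squared distance at step [K] is kept on the left so that the induction
   telescopes. *)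
suff : \int[Pr]_w sqn (x K w - z) + c * \sum_(k < K) \int[Pr]_w M (x k w)
    <= sqn (x0 - z).
  by apply: le_trans; rewrite lerDr; apply: mean_ge0 => w; exact: sqn_ge0.
elim: K => [|K IH]; first by rewrite big_ord0 mulr0 addr0 /= (mean_cst Pr (sqn (x0 - z))).
rewrite big_ord_recr /= mulrDr; apply: le_trans IH.
have := step K; lra.
Qed.

Lemma spa_cvg (c amax : R) : 0 < c ->
  (forall k, c <= 2 * alpha k - alpha k ^+ 2 * gammaN) ->
  (forall k, alpha k <= amax) ->
  [set y | P [set s | XS s y] = 1%E] `<=` X ->
  {ae Pr, forall w, (exists2 y, X y & x k w @[k --> \oo] --> y) /\
    M (x k w) @[k --> \oo] --> (0 : R)}.
Proof.
move=> c0 ca amaxP exact_X; have [z Xz] := X0.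
have amax0 : 0 <= amax := le_trans (alpha_ge0 0%N) (amaxP 0%N).
pose L := sqn (x0 - z) / c.
have sumM K : \sum_(k < K) \int[Pr]_w M (x k w) <= L.
  by rewrite /L ler_pdivlMr// mulrC; exact: sum_mean_sqdist_le.
(* The mean squared residual of the samples actually drawn; its expectation is that of [M (x k)], so
   it has the same summability. *)
pose D k w := N%:R^-1 * \sum_i sqn (r k i w).
have br1 k i : bounded_measurable (fun w => sqn (r k i w)).
  by apply: bounded_measurable_dotv; [exact: mr|exact: br|exact: mr|exact: br].
have bsD k : bounded_measurable (fun w => \sum_i sqn (r k i w)).
  exact: bounded_measurable_sum.
have bD k : bounded_measurable (D k).
  by apply: bounded_measurableM => //; exact: bounded_measurable_cst.
have D0 k w : 0 <= D k w.
  by rewrite mulr_ge0 ?invr_ge0//; apply: sumr_ge0 => i _; exact: sqn_ge0.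
have ED k : \int[Pr]_w D k w = \int[Pr]_w M (x k w).
  rewrite meanZ// mean_sum//.
  under eq_bigr => i _.
    have := mean_residual_sqr k measurableT i.
    rewrite indicT; under eq_Rintegral do rewrite mul1r.
    under [RHS]eq_Rintegral do rewrite mul1r.
    move=> ->; over.
  rewrite sumr_const card_ord -[(Rintegral _ _ _) *+ N]mulr_natl mulrA mulVf ?mul1r//.
  by rewrite pnatr_eq0 -lt0n.
pose b k w := alpha k ^+ 2 * D k w.
have bb k : bounded_measurable (b k).
  by apply: bounded_measurableM => //; exact: bounded_measurable_cst.
have aeb : {ae Pr, forall w, cvgn (series (b ^~ w))}.
  apply: (@ae_cvg_series _ _ _ Pr b (amax ^+ 2 * L)) => //.
    by move=> k w; rewrite mulr_ge0// sqr_ge0.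
  move=> K; apply: (@le_trans _ _ (amax ^+ 2 * \sum_(k < K) \int[Pr]_w M (x k w))).
    rewrite mulr_sumr; apply: ler_sum => k _; rewrite meanZ// ED.
    apply: ler_wpM2r; first by apply: mean_ge0 => w; exact: mean_sqdist_ge0.
    by rewrite ler_sqr ?nnegrE.
  by apply: ler_wpM2l => //; exact: sqr_ge0.
have aeM : {ae Pr, forall w, cvgn (series (fun k => M (x k w)))}.
  apply: (@ae_cvg_series _ _ _ Pr (fun k w => M (x k w)) L) => // k w.
  exact: mean_sqdist_ge0.
(* From here on a single path is fixed and the argument is deterministic. *)
apply: filterS2 aeb aeM => w cb cM.
have M0 : M (x k w) @[k --> \oo] --> (0 : R) by exact: cvg_series_cvg_0 cM.
split=> //; apply: (quasi_fejer_cvg (b := b ^~ w)) => //.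
- by move=> k; rewrite mulr_ge0// sqr_ge0.
- by move=> y k Xy; exact: sqn_spaS_le.
move=> y cy; apply: exact_X; apply: (mean_sqdist_eq0 X0) => //.
(* [M y <= e] for every [e > 0]: at a late index with both [M (x k w)] and the squared distance to
   [y] below [e / 4], the perturbation bound adds up to [e]. *)
apply/eqP; rewrite eq_le mean_sqdist_ge0 andbT; apply/ler_addgt0Pr => e e0.
rewrite add0r.
have e40 : 0 < e / 4 by rewrite divr_gt0.
have [K _ MK] : \forall k \near \oo, M (x k w) < e / 4.
  have /cvgrPdist_lt/(_ _ e40) := M0.
  apply: filterS => k; rewrite sub0r normrN; exact: le_lt_trans (ler_norm _).
have [k Kk xky] := cluster_sqn cy K e40.
have : M y <= 2 * M (x k w) + 2 * sqn (y - x k w).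
  exact: (mean_sqdist_perturb X0).
have := MK k Kk; rewrite sqnBC /= in xky *; lra.
Qed.

End stepsizes.
End iterates.

(** * Stepsize arithmetic and the theorem *)

Lemma gamma_minibatch_gt0 (R : realType) (N : nat) (gamma : R) :
  (0 < N)%N -> 0 <= gamma -> 0 < gamma_minibatch N gamma.
Proof.
move=> N0 g0; have NR : 0 < N%:R :> R by rewrite ltr0n.
rewrite ltr_wpDr ?invr_gt0// mulr_ge0// subr_ge0 invf_le1// ler1n.
exact: N0.
Qed.

Lemma gamma_minibatch_le1 (R : realType) (N : nat) (gamma : R) :
  (0 < N)%N -> gamma <= 1 -> gamma_minibatch N gamma <= 1.
Proof.
move=> N0 g1; have NR : 0 < N%:R :> R by rewrite ltr0n.
rewrite /gamma_minibatch -lerBrDl -[leRHS]mulr1; apply: ler_wpM2l => //.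
by rewrite subr_ge0 invf_le1// ler1n.
Qed.

(** Completing the square: the gap is [g * (a - g^-1) ^+ 2], which also identifies the only
    maximiser. *)
Lemma descent_factor_leif (R : realType) (g a : R) : 0 < g ->
  2 * a - a ^+ 2 * g <= 2 * g^-1 - g^-1 ^+ 2 * g ?= iff (a == g^-1).
Proof.
move=> g0; have gn0 : g != 0 by rewrite gt_eqF.
have E : 2 * g^-1 - g^-1 ^+ 2 * g - (2 * a - a ^+ 2 * g) = g * (a - g^-1) ^+ 2.
  by field.
split; first by rewrite -subr_ge0 E mulr_ge0 ?sqr_ge0// ltW.
by rewrite eq_sym -subr_eq0 E mulf_eq0 (negPf gn0) sqrf_eq0 subr_eq0.
Qed.

Theorem theorem8 (R : realType) (n : nat)
    (X : set 'rV[R]_n)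
    (Xclosed : closed X) (Xconvex : convex_set X) (Xnonempty : X !=set0)
    (d : measure_display) (Omega : measurableType d) (P : probability Omega R)
    (XS : Omega -> set 'rV[R]_n)
    (XSclosed : forall s, closed (XS s))
    (XSconvex : forall s, convex_set (XS s))
    (XsubXS : forall s, X `<=` XS s)
    (proj_meas : measurable_fun setT
      ((fun z => proj (XS z.1) z.2) : Omega * borel_rV R n -> borel_rV R n))
    (gamma : R)
    (gamma_in : gamma_constants P XS gamma)
    (gamma_least : lbound (gamma_constants P XS) gamma)
    (N : nat) (N_ge1 : (1 <= N)%N)
    (dT : measure_display) (T : measurableType dT) (Pr : probability T R)
    (S : nat * 'I_N -> T -> Omega) (S_iid : iid_samples Pr P S)
    (x0 : 'rV[R]_n) (alpha : nat -> R) :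
  let gammaN := gamma_minibatch N gamma in
  let x := spa XS x0 alpha S in
  (forall k, 0 < alpha k < 2 / gammaN) ->
  [/\ gammaN <= 1,
      (forall (k : nat) (xstar : 'rV[R]_n), X xstar ->
        let sigma_xk := sigma_generated (x k : T -> borel_rV R n) in
        let Y := fun w => enorm (x k.+1 w - xstar) ^+ 2 in
        (exists Z : T -> R, is_cond_expectation Pr sigma_xk Y Z) /\
        (forall Z : T -> R, is_cond_expectation Pr sigma_xk Y Z ->
          {ae Pr, forall w, Z w <= enorm (x k w - xstar) ^+ 2
            - 2 * (2 * alpha k - alpha k ^+ 2 * gammaN) * F P XS (x k w)})),
      (0 < gammaN^-1 < 2 / gammaN /\
       forall a : R, 0 < a < 2 / gammaN ->
         2 * a - a ^+ 2 * gammaN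
           <= 2 * gammaN^-1 - gammaN^-1 ^+ 2 * gammaN ?= iff (a == gammaN^-1)) &
      (X = [set y | P [set s | XS s y] = 1%E] ->
       forall delta : R, 0 < delta <= gammaN^-1 ->
       (forall k, delta <= alpha k <= 2 / gammaN - delta) ->
       (exists xinf : T -> 'rV[R]_n,
          measurable_fun setT (xinf : T -> borel_rV R n) /\
          {ae Pr, forall w, X (xinf w) /\ (fun k => x k w) @ \oo --> xinf w}) /\
       {ae Pr, forall w, (fun k => F P XS (x k w)) @ \oo --> (0 : R)})].
Proof.
move=> gammaN x alphaP.
have [gamma0 gammaP] := gamma_in.
have alpha0 k : 0 <= alpha k by have /andP[/ltW] := alphaP k.
have gP y : sqn (mean_residual P XS y) <= gamma * mean_sqdist P XS y.
  by rewrite -enorm_sqr; exact: gammaP.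
(* By Jensen 1 is an admissible constant, and [gamma] is the least one. *)
have gamma1 : gamma <= 1.
  apply: gamma_least; split=> // y; rewrite mul1r enorm_sqr.
  exact: (sqn_mean_residual_le Xnonempty).
have gN0 : 0 < gammaN by exact: gamma_minibatch_gt0.
split.
- exact: gamma_minibatch_le1.
- move=> k z Xz sigma_xk Y.
  have condZ : is_cond_expectation Pr sigma_xk Y
      (fun w => second_moment P XS N alpha k z (x k w)).
    exact: (is_cond_expectation_spaS Xnonempty).
  split; first by exists (fun w => second_moment P XS N alpha k z (x k w)).
  move=> Z /cond_expectation_le/(_ condZ).
  have sG : sigma_algebra setT sigma_xk.
    exact/sigma_algebra_preimage/sigma_algebra_measurable.
  move=> /(_ sG); apply: filterS => w /le_trans; apply.
  rewrite enorm_sqr /F mulrA [2 * (_ - _)]mulrC mulfK ?pnatr_eq0//.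
  exact: (second_moment_le Xnonempty).
- split=> [|a _]; last exact: descent_factor_leif.
  by rewrite invr_gt0 gN0/= -[ltLHS]mul1r ltr_pM2r ?invr_gt0// ltr1n.
- move=> exact_X delta /andP[delta0 _] delta_alpha.
  have aecvg : {ae Pr, forall w, (exists2 y, X y & x k w @[k --> \oo] --> y) /\
      mean_sqdist P XS (x k w) @[k --> \oo] --> (0 : R)}.
    (* The descent factor equals [alpha k * (gammaN * (2 / gammaN - alpha k))], and both [alpha k]
       and [2 / gammaN - alpha k] are at least [delta]; hence the constant
       [delta * (gammaN * delta)]. *)
    apply: (@spa_cvg R n X Xnonempty d Omega P XS XSclosed XSconvex XsubXS
      proj_meas N N_ge1 x0 alpha dT T Pr S alpha0 S_iid gamma gP
      (delta * (gammaN * delta)) (2 / gammaN)).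
    + by rewrite !mulr_gt0.
    + move=> k; have /andP[h1 h2] := delta_alpha k.
      rewrite -/gammaN (_ : 2 * _ - _ = alpha k * (gammaN * (2 / gammaN - alpha k))).
        apply: ler_pM => //; [exact: ltW|by rewrite mulr_ge0 ?ltW|].
        by rewrite ler_pM2l// lerBrDl -lerBrDr.
      by field; rewrite gt_eqF.
    + by move=> k; have /andP[_ /ltW] := alphaP k.
    + by rewrite [in X in _ `<=` X]exact_X.
  split; last first.
    apply: filterS aecvg => w [_ M0]; rewrite -[X in _ --> X](mulr0 2^-1).
    by apply: cvgM => //; exact: cvg_cst.
  have mx k : measurable_fun setT (x k : T -> borel_rV R n).
    exact: (measurable_iterate proj_meas N_ge1 x0 alpha S_iid).
  have [v mv vE] := measurable_limit mx.
  exists v; split=> //; apply: filterS aecvg => w [[y Xy xy] _].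
  by rewrite (vE w y xy).
Qed.
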